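(* Let $k\ge 1$, let $\pi_\beta$ be a strictly positive, continuously differentiable density on $\mathbb{R}^k$ that is sub-exponentially light, and suppose there exist $\alpha>k$ and $R_0<\infty$ such that $$\frac{\beta}{|\beta|}\cdot\nabla\log\pi_\beta(\beta)\le-\frac{\alpha}{|\beta|},\qquad |\beta|>R_0.$$ Let $R\ge0$, $p>2$, $b>0$. Define $f_1,f_2:[0,\infty)\to[0,\infty)$ by $$f_1(x)=\begin{cases}x,&x<R,\\ x+(x-R)^p,&x\ge R,\end{cases}\qquad f_2(x)=\begin{cases}e^{bx}-\frac e3,&x>\frac1b,\\ x^3\frac{b^3e}{6}+x\frac{be}{2},&x\le\frac1b,\end{cases}$$ and for $i=1,2$ define $h_i:\mathbb{R}^k\to\mathbb{R}^k$ by $h_i(\gamma)=f_i(|\gamma|)\,\gamma/|\gamma|$ for $\gamma\neq0$ and $h_i(0)=0$. Let $h=h_2\circ h_1$ (so the change of variable is $\gamma=h_1^{-1}(h_2^{-1}(\beta))$). Then the density $$\pi_\gamma(\gamma)=\pi_\beta\bigl(h(\gamma)\bigr)\,\bigl|\det\nabla h(\gamma)\bigr|,\qquad \gamma\in\mathbb{R}^k,$$ is super-exponentially light.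
   Context: $|\cdot|$ denotes the Euclidean norm on $\mathbb{R}^k$, and $\cdot$ between vectors the inner product; $e$ is the base of the natural logarithm. Densities are with respect to Lebesgue measure. $\nabla h(\gamma)$ is the Jacobian matrix of $h$. For a strictly positive continuously differentiable density $\pi$ on $\mathbb{R}^k$ consider $$L(\pi)=\limsup_{|x|\to\infty}\frac{x}{|x|}\cdot\nabla\log\pi(x)\in[-\infty,\infty].$$ $\pi$ is called super-exponentially light if $L(\pi)=-\infty$, exponentially light if $L(\pi)<0$ (the value $-\infty$ is allowed), and sub-exponentially light if $L(\pi)=0$. *)

(* Defs.v *)
From HB Require Import structures.
From mathcomp Require Import all_boot all_order all_algebra.
From mathcomp Require Import all_classical all_reals all_analysis.

Set Implicit Arguments.
Unset Strict Implicit.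
Unset Printing Implicit Defensive.

Import Order.TTheory GRing.Theory Num.Theory.
Import numFieldNormedType.Exports.

Local Open Scope classical_set_scope.
Local Open Scope ring_scope.

(* The norm `|x| of the library on 'rV[R]_k is the sup norm; it is used only
   through the topology and the differential, which do not depend on the choice
   of a norm. *)
Section euclidean.
Context {R : realType} {k : nat}.
Implicit Types x y : 'rV[R]_k.

Definition dotv x y : R := \sum_(i < k) x 0 i * y 0 i.

Definition enorm x : R := Num.sqrt (dotv x x).

(* x / |x|, with value 0 at x = 0. *)
Definition dirv x : 'rV[R]_k := (enorm x)^-1 *: x.

Definition grad (f : 'rV[R]_k -> R) x : 'rV[R]_k :=
  \row_(i < k) 'D_(delta_mx 0 i) f x.

Definition enorm_pinfty : set_system 'rV[R]_k :=
  [set A | exists M : R, forall x, M < enorm x -> A x].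

End euclidean.

(* k-dimensional Lebesgue measure, as an iterated product of the measure on the
   line, carried by k-tuples with the product sigma-algebra. *)
Section lebesgue.
Context {R : realType}.
Local Notation mR := (measurableTypeR R).

Definition cons_pair n (x : mR * n.-tuple mR) : n.+1.-tuple mR :=
  [tuple of x.1 :: x.2].

Lemma measurable_cons_pair n : measurable_fun setT (@cons_pair n).
Proof. exact: measurable_cons. Qed.

Section step.
Context (n : nat) (mu : {sigma_finite_measure set (n.-tuple mR) -> \bar R}).

Definition lebesgue_step : set (n.+1.-tuple mR) -> \bar R :=
  pushforward ((@lebesgue_measure R) \x mu)%E (@cons_pair n).

Let lebesgue_step0 : (lebesgue_step set0 = 0)%E.
Proof. by rewrite /lebesgue_step /pushforward preimage_set0 measure0. Qed.

Let lebesgue_step_ge0 A : (0 <= lebesgue_step A)%E.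
Proof. exact: (measure_ge0 (lebesgue_measure \x mu)%E). Qed.

Let lebesgue_step_sigma_additive : semi_sigma_additive lebesgue_step.
Proof.
move=> F mF tF mUF; rewrite /lebesgue_step /pushforward preimage_bigcup.
apply: measure_semi_sigma_additive.
- by move=> i; rewrite -[X in measurable X]setTI; exact: measurable_cons_pair.
- apply/trivIsetP => /= i j _ _ ij; rewrite -preimage_setI.
  by move/trivIsetP : tF => /(_ _ _ _ _ ij) ->//; rewrite preimage_set0.
- rewrite -preimage_bigcup -[X in measurable X]setTI.
  exact: measurable_cons_pair.
Qed.

HB.instance Definition _ := isMeasure.Build _ _ _ lebesgue_step
  lebesgue_step0 lebesgue_step_ge0 lebesgue_step_sigma_additive.

Lemma lebesgue_step_sigma_finite : sigma_finite setT lebesgue_step.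
Proof.
have /sigma_finiteP[F [TF ndF Foo]] := sigma_finiteT (@lebesgue_measure R).
have /sigma_finiteP[G [TG ndG Goo]] := sigma_finiteT mu.
exists (fun i => [set t | F i (thead t) /\ G i [tuple of behead t]]).
  apply/esym; rewrite -subTset => t _.
  have [i _ Fi] : (\bigcup_i F i) (thead t) by rewrite -TF.
  have [j _ Gj] : (\bigcup_i G i) [tuple of behead t] by rewrite -TG.
  exists (maxn i j) => //; split.
    by move: Fi; exact/subsetPset/ndF/leq_maxl.
  by move: Gj; exact/subsetPset/ndG/leq_maxr.
move=> i; have [mF Fy] := Foo i; have [mG Gy] := Goo i; split.
  have -> : [set t : n.+1.-tuple mR | F i (thead t) /\ G i [tuple of behead t]]
    = (@tnth _ mR ^~ ord0 @^-1` F i)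
      `&` ((fun t : n.+1.-tuple mR => [tuple of behead t]) @^-1` G i) by [].
  apply: measurableI.
    by rewrite -[X in measurable X]setTI; exact: measurable_tnth.
  by rewrite -[X in measurable X]setTI; exact: measurable_behead.
rewrite /lebesgue_step /pushforward.
rewrite (_ : _ @^-1` _ = F i `*` G i); last first.
  apply/seteqP; split=> -[x t]; rewrite /cons_pair/= theadE => -[Fx Gt].
    by split=> //=; congr (G i _): Gt; exact: val_inj.
  by split=> //; congr (G i _): Gt; exact: val_inj.
by rewrite product_measure1E// lte_mul_pinfty// ge0_fin_numE.
Qed.

HB.instance Definition _ := Measure_isSigmaFinite.Build _ _ _ lebesgue_step
  lebesgue_step_sigma_finite.

End step.

Fixpoint lebesgue_tuple n : {sigma_finite_measure set (n.-tuple mR) -> \bar R} :=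
  if n is m.+1 then lebesgue_step (lebesgue_tuple m)
  else \d_([tuple] : 0.-tuple mR).

Lemma lebesgue_tuple_box n (A : 'I_n -> set mR) :
  (forall i, measurable (A i)) ->
  (lebesgue_tuple n [set t | forall i, A i (tnth t i)]
    = \prod_(i < n) lebesgue_measure (A i))%E.
Proof.
elim: n A => [|n IH] A mA.
  rewrite big_ord0 (_ : [set _ | _] = setT); first exact: diracT.
  by apply/seteqP; split=> // t _ -[].
rewrite big_ord_recl/= /lebesgue_step /pushforward.
rewrite (_ : _ @^-1` _ =
    A ord0 `*` [set t | forall i, A (lift ord0 i) (tnth t i)]); last first.
  apply/seteqP; split=> -[x t]; rewrite /cons_pair/=.
    move=> At; split=> [|i] /=; first exact: (At ord0).
    by have := At (lift ord0 i); rewrite tnthS.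
  move=> [/= Ax At] i; have [j ->|->] := unliftP ord0 i; last by [].
  by rewrite tnthS.
have mB : measurable
    [set t : n.-tuple mR | forall i, A (lift ord0 i) (tnth t i)].
  have -> : [set t : n.-tuple mR | forall i, A (lift ord0 i) (tnth t i)] =
      \big[setI/setT]_(i < n) (@tnth _ mR ^~ i @^-1` A (lift ord0 i)).
    by rewrite -bigcap_seq; apply/seteqP; split=> t /= At i => [_|];
      [exact: At|apply: At; rewrite /= mem_index_enum].
  apply: bigsetI_measurable => i _.
  by rewrite -[X in measurable X]setTI; exact: measurable_tnth.
rewrite product_measure1E//; congr (_ * _)%E; exact: IH.
Qed.

End lebesgue.

Section lightness.
Context {R : realType} {k : nat}.
Implicit Types pi : 'rV[R]_k -> R.

(* Probability density; for k-tuples t, \row_i tnth t i is t as a row vector. *)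
Definition is_density pi :=
  (forall x, 0 <= pi x) /\
  (\int[lebesgue_tuple k]_t (pi (\row_(i < k) tnth t i))%:E = 1)%E.

Definition continuously_differentiable pi :=
  (forall x, differentiable pi x) /\ continuous (grad pi).

Definition C1_positive_density pi :=
  [/\ is_density pi, forall x, 0 < pi x & continuously_differentiable pi].

(* limsup, in the extended reals, of (x / |x|) . grad (log pi) x as |x| tends
   to infinity. *)
Definition light_index pi : \bar R :=
  limf_esup (fun x => (dotv (dirv x) (grad (@ln R \o pi) x))%:E) enorm_pinfty.

Definition super_exponentially_light pi :=
  C1_positive_density pi /\ light_index pi = -oo%E.

Definition sub_exponentially_light pi :=
  C1_positive_density pi /\ light_index pi = 0%E.

End lightness.

Section transformation.
Context {R : realType}.

(* f1 and f2 are only ever evaluated on nonnegative arguments. *)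
Definition f1 (r p x : R) : R := if x < r then x else x + (x - r) `^ p.

Definition f2 (b x : R) : R :=
  let e := expR 1 in
  if b^-1 < x then expR (b * x) - e / 3
  else x ^+ 3 * (b ^+ 3 * e / 6) + x * (b * e / 2).

Definition radial k (f : R -> R) (x : 'rV[R]_k) : 'rV[R]_k :=
  if x == 0 then 0 else (f (enorm x) / enorm x) *: x.

(* The library's Jacobian 'J h x acts on row vectors, hence is the transpose of
   the usual one; the determinant is the same. *)
Definition transformed k (h : 'rV[R]_k -> 'rV[R]_k) (pi : 'rV[R]_k -> R)
  (x : 'rV[R]_k) : R := pi (h x) * `|\det ('J h x)|.

End transformation.

(* Main.v *)
Require Import Defs.
From HB Require Import structures.
From mathcomp Require Import all_boot all_order all_algebra.
From mathcomp Require Import all_classical all_reals all_analysis.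
From mathcomp Require Import measurable_realfun.
From mathcomp Require Import ring lra.

(** The map h is radial: h x = f(|x|) x/|x| with profile f = f_2 o f_1, which is
    of class C^2 on the line with f(0) = f''(0) = 0 and f' > 0.  Put
    psi(s) = f(s)/s and psi(0) = f'(0), so that h x = psi(|x|) x, and let
    k = m + 1 be the dimension.

    Regularity.  Away from the origin everything is smooth enough; at the origin
    a function q(|x|) is C^1 as soon as q is C^1 with q'(0) = 0
    ([is_diff_radial_fun], [continuous_radial_field]).  By the mean value
    theorem f''(0) = 0 gives psi'(0) = 0 ([quot_second_order]).  The Jacobian of
    h is psi(|x|) times the identity plus a matrix of rank one, hence its
    determinant is J(|x|) with J = psi^m f' ([det_jacobian_radial]), again a C^1
    function of |x|, and the transformed function is C^1 and positive.

    Total mass.  Change of variables for a radial map reduces to dimension one.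
    For t <> 0 the weights |t|^-1 exp(-s/|t|) integrate to 1 over s > 0.  Insert
    them in the integral of K, exchange the integrals, substitute s t for t
    (which multiplies Lebesgue measure by s^k), and exchange back:
      int K(t) dt
        = int |t|^-1 exp(-1/|t|) (int_(s > 0) K(s t) s^m ds) dt
    ([ge0_integral_polar]).  For K = (F o h) J(|.|), the inner integral is turned
    into that of K = F by the substitution u = f(s|t|)/|t|, so both functions
    have the same integral ([integral_radial]).

    Lightness.  Differentiate log pi_gamma along the ray through x.  For s = |x|
    large enough, the hypothesis on pi_beta gives
      (x/|x|) . grad log pi_gamma <= f''/f' - (alpha - m) f'/f   at s
    ([radial_log_derivative_le]).  For large s one has f = exp(b g) - e/3 with
    g = f_1, hence f'/f >= b g' and f''/f' = b g' + g''/g'.  The bound becomes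
    g''/g' - (alpha - k) b g', which tends to -oo because g' grows at least
    linearly while g''/g' stays bounded ([f12_log_derivative_bound]). *)

Set Implicit Arguments.
Unset Strict Implicit.
Unset Printing Implicit Defensive.

Import Order.TTheory GRing.Theory Num.Theory.
Import numFieldNormedType.Exports.
Local Open Scope classical_set_scope.
Local Open Scope ring_scope.

(** * Dilations of Lebesgue measure *)

Section scaling.
Context {R : realType}.
Local Notation mR := (measurableTypeR R).
Local Notation lam := (@lebesgue_measure R).

Definition row_of_tuple {n} (t : n.-tuple R) : 'rV[R]_n := \row_(i < n) tnth t i.

Definition scale_tuple {n} (c : R) (t : n.-tuple R) : n.-tuple R :=
  map_tuple ( *%R c) t.

Lemma row_of_tupleZ n c (t : n.-tuple R) :
  row_of_tuple (scale_tuple c t) = c *: row_of_tuple t.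
Proof. by apply/rowP => i; rewrite !mxE tnth_map. Qed.

Lemma measurable_scale_line (c : R) : measurable_fun [set: mR] ( *%R c : mR -> mR).
Proof. exact: mulrl_measurable. Qed.

(** The image of Lebesgue measure under x |-> c x, renormalized by c; it agrees
    with Lebesgue measure on half-open intervals, hence everywhere. *)
Definition scaled_lebesgue (c : R) (c0 : 0 < c) : {measure set mR -> \bar R} :=
  mscale (NngNum (ltW c0))
    (measure_function_pushforward__canonical__measure_function_Measure
      lam (measurable_scale_line c)).

Lemma scaled_lebesgueE (c : R) (c0 : 0 < c) (A : set mR) :
  measurable A -> scaled_lebesgue c0 A = lam A.
Proof.
move=> mA; apply/esym/lebesgue_measure_unique => //= _ [[a b]] _ <-.
rewrite /scaled_lebesgue/= /mscale/= /pushforward.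
rewrite (_ : _ @^-1` _ = `]c^-1 * a, c^-1 * b]%classic).
  rewrite !lebesgue_measure_itv/= !lte_fin ltr_pM2l ?invr_gt0//.
  case: ifPn => _; last by rewrite mule0.
  by rewrite -!EFinB -EFinM -mulrBr mulVKf ?gt_eqF.
apply/seteqP.
split=> x /=; rewrite !in_itv/= => /andP[h1 h2]; apply/andP.
  by rewrite ltr_pdivrMl// ler_pdivlMl.
by rewrite -ltr_pdivrMl// -ler_pdivlMl.
Qed.

Lemma ge0_integral_scale (c : R) (g : mR -> \bar R) : 0 < c ->
  measurable_fun setT g -> (forall x, 0 <= g x)%E ->
  (\int[lam]_x g x = c%:E * \int[lam]_x g (c * x)%R)%E.
Proof.
move=> c0 mg g0.
rewrite -(@eq_measure_integral _ _ _ _ lam (scaled_lebesgue c0)); last first.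
  by move=> A mA _; exact: scaled_lebesgueE.
rewrite ge0_integral_mscale//= ge0_integral_pushforward//.
Qed.

Local Notation leb n := (lebesgue_tuple (R := R) n).

Lemma measurable_scale_tuple n (c : R) :
  measurable_fun [set: n.-tuple mR] (@scale_tuple n c : n.-tuple mR -> n.-tuple mR).
Proof.
apply/measurable_fun_tnthP => i.
rewrite (_ : _ \o _ = *%R c \o (@tnth n mR ^~ i)); last first.
  by apply/funext => t /=; rewrite tnth_map.
apply: measurableT_comp; first exact: mulrl_measurable.
exact: measurable_tnth.
Qed.

Lemma ge0_integral_lebesgue_tupleS n (K : n.+1.-tuple mR -> \bar R) :
  measurable_fun setT K -> (forall t, 0 <= K t)%E ->
  (\int[leb n.+1]_t K t = \int[lam]_x \int[leb n]_t K (cons_pair (x, t)))%E.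
Proof.
move=> mK K0.
rewrite [LHS](ge0_integral_pushforward (@measurable_cons_pair R n))//.
rewrite preimage_setT fubini_tonelli1//.
  by apply: measurableT_comp => //; exact: measurable_cons_pair.
by move=> xt; exact: K0.
Qed.

(** One factor c per coordinate, by induction on the dimension: the first
    coordinate is split off by Tonelli and rescaled on its own. *)
Lemma ge0_integral_scale_tuple n (c : R) (K : n.-tuple mR -> \bar R) : 0 < c ->
  measurable_fun setT K -> (forall t, 0 <= K t)%E ->
  (\int[leb n]_t K t = (c ^+ n)%:E * \int[leb n]_t K (scale_tuple c t))%E.
Proof.
move=> c0; elim: n K => [|n IH] K mK K0.
  rewrite expr0 mul1e; apply: eq_integral => t _.
  by rewrite (tuple0 t) (tuple0 (scale_tuple _ _)).
have mKs : measurable_fun setT (fun t : n.+1.-tuple mR => K (scale_tuple c t)).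
  by apply: measurableT_comp => //; exact: measurable_scale_tuple.
have mKc : measurable_fun setT (fun xt : mR * n.-tuple mR => K (cons_pair xt)).
  by apply: measurableT_comp => //; exact: measurable_cons_pair.
rewrite !ge0_integral_lebesgue_tupleS//.
rewrite (ge0_integral_scale c0); last 2 first.
- exact: (measurable_fun_fubini_tonelli_F (fun xt => K (cons_pair xt)) mKc).
- by move=> x; exact: integral_ge0.
rewrite exprS EFinM -muleA; congr (_ * _)%E.
rewrite -ge0_integralZl_EFin//; last 3 first.
- by move=> x _; exact: integral_ge0.
- apply: (measurable_fun_fubini_tonelli_F
    (fun xt => K (scale_tuple c (cons_pair xt)))) => //.
  exact: (measurableT_comp mKs (@measurable_cons_pair R n)).
- exact: exprn_ge0 (ltW c0).
apply: eq_integral => x _.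
rewrite IH//; last exact: (measurableT_comp mKc (pair1_measurable _)).
congr (_ * _)%E; apply: eq_integral => t _; congr K.
exact: val_inj.
Qed.

End scaling.

(** * Measurability of continuous functions of several variables *)

Section measurability.
Context {R : realType}.
Local Notation mR := (measurableTypeR R).

Lemma measurable_tuple_box n (A : 'I_n -> set mR) :
  (forall i, measurable (A i)) ->
  measurable [set t : n.-tuple mR | forall i, A i (tnth t i)].
Proof.
move=> mA.
have -> : [set t : n.-tuple mR | forall i, A i (tnth t i)] =
    \big[setI/setT]_(i < n) (@tnth _ mR ^~ i @^-1` A i).
  by rewrite -bigcap_seq; apply/seteqP; split=> t /= At i => [_|];
    [exact: At|apply: At; rewrite /= mem_index_enum].
apply: bigsetI_measurable => i _.
by rewrite -[X in measurable X]setTI; exact: measurable_tnth.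
Qed.

(** The topology comes from the sup norm and the sigma-algebra from the
    coordinates.  An open set is the union of the boxes it contains that have a
    rational centre and a radius 1/(N + 1), and there are countably many. *)
Lemma open_measurable_row n (U : set 'rV[R]_n) : open U ->
  measurable [set t : n.-tuple mR | U (row_of_tuple t)].
Proof.
move=> oU.
pose c (q : n.-tuple rat) : 'rV[R]_n := \row_i ratr (tnth q i).
pose box (q : n.-tuple rat * nat) : set (n.-tuple mR) :=
  [set t | (ball (c q.1) q.2.+1%:R^-1 `<=` U) /\
           forall i, ball (ratr (tnth q.1 i) : R) q.2.+1%:R^-1 (tnth t i)].
rewrite (_ : [set t | _] = \bigcup_q box q); last first.
  apply/seteqP; split=> [t Ut|t [q _ [qU tq]]]; last first.
    by apply: qU; split=> // i j; rewrite !mxE; exact: tq.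
  have [e /= e0 eU] : nbhs_ball (row_of_tuple t) U.
    by apply/nbhs_ballP; exact: open_nbhs_nbhs.
  have [N Ne] : exists N : nat, N.+1%:R^-1 < e / 2.
    have /ltr_add_invr[N] : 0 < e / 2 by rewrite divr_gt0.
    by rewrite add0r; exists N.
  have Hq i : exists q : rat, ball (ratr q : R) N.+1%:R^-1 (tnth t i).
    have : tnth t i - N.+1%:R^-1 < tnth t i + N.+1%:R^-1.
      by rewrite ltrD2l gtrN.
    move=> /rat_in_itvoo[q]; rewrite in_itv/= => tq; exists q.
    rewrite /ball/= ltr_distlC; move: tq; set d := _^-1 => /andP[tq1 tq2].
    by apply/andP; split; lra.
  have /choice [q qP] := Hq.
  exists ([tuple q i | i < n], N) => //; split=> [y [_ yq]|i] /=; last first.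
    by rewrite tnth_mktuple.
  apply: eU; split=> // i j; rewrite !mxE (ord1 i).
  have := yq 0 j; rewrite !mxE tnth_mktuple => h1; have := qP j => h2.
  move: h1 h2 Ne; rewrite /ball/=; set d := _^-1 => h1 h2 Ne.
  apply: (le_lt_trans (ler_distD (ratr (q j)) _ _)).
  by rewrite distrC in h2; lra.
apply: countable_bigcupT_measurable => //.
move=> [q N]; rewrite /box/=.
have [h|h] := pselect (ball (c q) N.+1%:R^-1 `<=` U); last first.
  rewrite (_ : [set _ | _] = set0)//.
  by apply/seteqP; split=> // t [].
rewrite (_ : [set _ | _] =
  [set t : n.-tuple mR | forall i, ball (ratr (tnth q i) : R) N.+1%:R^-1 (tnth t i)]).
  apply: (@measurable_tuple_box _ (fun i => ball (ratr (tnth q i) : R) N.+1%:R^-1)) => i.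
  exact: measurable_ball.
by apply/seteqP; split=> t // [].
Qed.

Lemma continuous_measurable_row n (F : 'rV[R]_n -> R) : continuous F ->
  measurable_fun [set: n.-tuple mR] (fun t : n.-tuple mR => F (row_of_tuple t)).
Proof.
move=> cF; apply: (measurability _ (RGenOInfty.measurableE R)).
move=> _ [_ [a ->] <-]; rewrite setTI.
apply: (@open_measurable_row _ (F @^-1` `]a, +oo[%classic)).
by apply: open_comp => // x _; exact: cF.
Qed.

End measurability.

(** * Substitution on the half-line *)

Section substitution.
Context {R : realType}.
Local Notation mR := (measurableTypeR R).
Local Notation lam := (@lebesgue_measure R).

Lemma gt0_is_derive_lt (f df : R -> R) :
  (forall x : R, is_derive x 1 f (df x)) -> (forall x, 0 < df x) ->
  {homo f : x y / x < y}.
Proof.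
move=> fdf df0 x y xy.
have [|c _ e] := @MVT _ f df _ _ xy (fun z _ => fdf z).
  apply: derivable_within_continuous => z _; exact: (@ex_derive _ _ _ _ _ _ _ (fdf z)).
by rewrite -subr_gt0 e mulr_gt0// subr_gt0.
Qed.

Lemma is_derive_continuous (f df : R -> R) :
  (forall x : R, is_derive x 1 f (df x)) -> continuous f.
Proof.
move=> fdf x; apply: differentiable_continuous; apply/derivable1_diffP.
exact: (@ex_derive _ _ _ _ _ _ _ (fdf x)).
Qed.

Lemma ge0_integral_itv0y (g : R -> R) : continuous g -> (forall x, 0 <= x -> 0 <= g x) ->
  (\int[lam]_(x in `]0%R, +oo[) (g x)%:E = \int[lam]_(x in `[0%R, +oo[) (g x)%:E)%E.
Proof.
move=> cg g0; apply: integral_itv_obnd_cbnd.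
apply/measurable_EFinP; apply: measurable_funTS.
exact: continuous_measurable_fun.
Qed.

(** The derivative of f may be unbounded at infinity: the substitution is made on
    each segment [0, n], and monotone convergence gives the half-line. *)
Lemma ge0_integration_by_substitution0y (f df g : R -> R) :
  (forall x : R, is_derive x 1 f (df x)) -> continuous df -> (forall x, 0 < df x) ->
  f 0 = 0 -> (forall M, exists x, M <= f x) ->
  continuous g -> (forall x, 0 <= x -> 0 <= g x) ->
  (\int[lam]_(x in `]0%R, +oo[) (g (f x) * df x)%:E =
   \int[lam]_(x in `]0%R, +oo[) (g x)%:E)%E.
Proof.
move=> fdf cdf df0 f0 fy cg g0.
have cf := is_derive_continuous fdf.
have finc := gt0_is_derive_lt fdf df0.
have cgf : continuous (fun x => g (f x) * df x).
  move=> x; apply: continuousM; last exact: cdf.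
  by apply: continuous_comp; [exact: cf|exact: cg].
have f_ge0 x : 0 <= x -> 0 <= f x.
  by rewrite le_eqVlt => /predU1P[<-|/finc]; rewrite f0// => /ltW.
have gf0 x : 0 <= x -> 0 <= g (f x) * df x.
  by move=> x0; rewrite mulr_ge0 ?g0 ?f_ge0// ltW.
rewrite !ge0_integral_itv0y//.
have f1E : derive1 f = df.
  by apply/funext => x; rewrite derive1E; exact: (@derive_val _ _ _ _ _ _ _ (fdf x)).
have E1 : (\bigcup_(n : nat) `[0, n%:R] = `[0 : R, +oo[)%classic.
  apply/seteqP; split=> [x [n _]|x]/=; rewrite !in_itv/= ?andbT.
    by case/andP.
  move=> x0; exists (Num.truncn x).+1 => //=; rewrite in_itv/= x0/=.
  exact/ltW/truncnS_gt.
have E2 : (\bigcup_(n : nat) `[0, f n%:R] = `[0 : R, +oo[)%classic.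
  apply/seteqP; split=> [x [n _]|x]/=; rewrite !in_itv/= ?andbT.
    by case/andP.
  move=> x0.
  have [y xy] := fy x; exists (Num.truncn y).+1 => //=; rewrite in_itv/= x0/=.
  exact/(le_trans xy)/ltW/finc/truncnS_gt.
rewrite -{1}E1 -E2.
have mE (F : R -> R) D : continuous F -> measurable_fun D (EFin \o F).
  move=> cF; apply/measurable_EFinP; apply: measurable_funTS.
  exact: continuous_measurable_fun.
have h1 := @ge0_nondecreasing_set_cvg_integral _ mR R
  (fun n : nat => `[0, n%:R]%classic) (fun x => (g (f x) * df x)%:E) lam.
have h2 := @ge0_nondecreasing_set_cvg_integral _ mR R
  (fun n : nat => `[0, f n%:R]%classic) (fun x => (g x)%:E) lam.
have fmono : {homo f : x y / x <= y} by exact/ltW_homo.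
have {h1}H1 := h1 _ _ _ _; have {h2}H2 := h2 _ _ _ _.
have seqE : (fun n : nat => \int[lam]_(x in `[0%R, n%:R]) (g (f x) * df x)%:E)%E =
    (fun n : nat => \int[lam]_(x in `[0%R, f n%:R]) (g x)%:E)%E.
  apply/funext => n.
  rewrite -{2}f0 (@integration_by_substitution_increasing _ f)//.
  - by apply: eq_integral => x _; rewrite f1E.
  - by move=> x y _ _; exact: finc.
  - by move=> x _; rewrite f1E; exact: cdf.
  - by rewrite f1E; apply/cvg_ex; exists (df 0); apply: cvg_at_right_filter; exact: cdf.
  - by rewrite f1E; apply/cvg_ex; exists (df n%:R); apply: cvg_at_left_filter; exact: cdf.
  - split.
    + by move=> x _; exact: (@ex_derive _ _ _ _ _ _ _ (fdf x)).
    + by apply: cvg_at_right_filter; exact: cf.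
    + by apply: cvg_at_left_filter; exact: cf.
  - exact: continuous_subspaceT.
move: H1 H2; rewrite seqE => H1 H2.
apply: (cvg_unique _ (H1 _ _ _ _) (H2 _ _ _ _)).
- exact: ereal_hausdorff.
- move=> m n mn; apply/subsetPset => x/=.
  by rewrite !in_itv/= => /andP[-> /le_trans]; apply; rewrite ler_nat.
- by move=> n; exact: measurable_itv.
- by move=> n; exact: mE.
- by move=> n x /=; rewrite in_itv/= lee_fin => /andP[x0 _]; exact: gf0.
- move=> m n mn; apply/subsetPset => x/=.
  rewrite !in_itv/= => /andP[-> /le_trans]; apply; apply: fmono.
  by rewrite ler_nat.
- by move=> n; exact: measurable_itv.
- by move=> n; exact: mE.
- by move=> n x /=; rewrite in_itv/= lee_fin => /andP[x0 _]; exact: g0.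
Qed.

End substitution.

(** * The Euclidean norm and the exponential weight *)

Section euclidean.
Context {R : realType}.
Local Notation mR := (measurableTypeR R).
Local Notation lam := (@lebesgue_measure R).
Local Notation leb n := (lebesgue_tuple (R := R) n).

Lemma dotvv_ge0 n (x : 'rV[R]_n) : 0 <= dotv x x.
Proof. by apply: sumr_ge0 => i _; rewrite -expr2 sqr_ge0. Qed.

Lemma enorm_ge0 n (x : 'rV[R]_n) : 0 <= enorm x.
Proof. exact: sqrtr_ge0. Qed.

Lemma sqr_enorm n (x : 'rV[R]_n) : enorm x ^+ 2 = dotv x x.
Proof. by rewrite sqr_sqrtr// dotvv_ge0. Qed.

Lemma enorm_eq0 n (x : 'rV[R]_n) : (enorm x == 0) = (x == 0).
Proof.
apply/idP/eqP => [|->]; last first.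
  by rewrite /enorm /dotv big1 ?sqrtr0// => i _; rewrite mxE mul0r.
rewrite -sqrf_eq0 sqr_enorm psumr_eq0; last first.
  by move=> i _; rewrite -expr2 sqr_ge0.
move=> /allP x0; apply/rowP => i; rewrite mxE; apply/eqP.
by have := x0 i (mem_index_enum _); rewrite mulf_eq0 orbb.
Qed.

Lemma enorm_gt0 n (x : 'rV[R]_n) : (0 < enorm x) = (x != 0).
Proof. by rewrite lt_def enorm_ge0 andbT enorm_eq0. Qed.

Lemma enormZ n c (x : 'rV[R]_n) : enorm (c *: x) = `|c| * enorm x.
Proof.
rewrite /enorm /dotv -[`|c|]sqrtr_sqr -sqrtrM ?sqr_ge0//; congr Num.sqrt.
by rewrite mulr_sumr; apply: eq_bigr => i _; rewrite !mxE; ring.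
Qed.

Lemma continuous_dotv n (f g : 'rV[R]_n -> 'rV[R]_n) :
  continuous f -> continuous g -> continuous (fun x => dotv (f x) (g x)).
Proof.
move=> cf cg; apply: continuous_big => [|i _ x]; first exact: add_continuous.
apply: (@continuousM _ _ (fun x => f x 0 i) (fun x => g x 0 i)).
  apply: (@continuous_comp _ _ _ f (fun M => M 0 i)); first exact: cf.
  exact: coord_continuous.
apply: (@continuous_comp _ _ _ g (fun M => M 0 i)); first exact: cg.
exact: coord_continuous.
Qed.

Lemma continuous_enorm n : continuous (@enorm R n).
Proof.
move=> x; apply: continuous_comp; last exact: sqrt_continuous.
by apply: continuous_dotv => y; exact: cvg_id.
Qed.

Lemma exponential_pdf0y (a : R) : 0 < a ->
  (\int[lam]_(x in `]0%R, +oo[) (a * expR (- (a * x)))%:E = 1)%E.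
Proof.
move=> a0; rewrite -(integral_exponential_pdf a0).
rewrite ge0_integral_itv0y; last 2 first.
- move=> x; apply: cvgM; first exact: cvg_cst.
  apply: continuous_comp; last exact: continuous_expR.
  by apply: cvgN; apply: cvgM; [exact: cvg_cst|exact: cvg_id].
- by move=> x _; rewrite mulr_ge0 ?expR_ge0 ?ltW.
rewrite integral_mkcond; apply: eq_integral => x _.
rewrite /exponential_pdf !patchE; case: ifPn => // _.
by rewrite mulNr.
Qed.

Lemma row_of_tuple_eq0 n : [set t : n.-tuple mR | row_of_tuple t = 0] =
  [set t | forall i, [set 0] (tnth t i)].
Proof.
apply/seteqP; split=> t /=.
  by move=> /rowP t0 i; have := t0 i; rewrite !mxE.
by move=> t0; apply/rowP => i; rewrite !mxE.
Qed.

(** The exponential weights of rate 1/|t| degenerate at t = 0 only, which is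
    harmless because the origin is negligible. *)
Lemma lebesgue_tuple_set0 n : leb n.+1 [set t | row_of_tuple t = 0] = 0%E.
Proof.
rewrite row_of_tuple_eq0 (@lebesgue_tuple_box _ _ (fun _ => [set 0]))//.
by rewrite big_ord_recl lebesgue_measure_set1 mul0e.
Qed.

Lemma measurable_inv_enorm n :
  measurable_fun [set: n.-tuple mR] (fun t : n.-tuple mR => (enorm (row_of_tuple t))^-1).
Proof.
under eq_fun do rewrite -powR_inv1 ?enorm_ge0//.
apply: (@measurableT_comp _ _ _ _ _ _ (fun x : mR => x `^ (-1))) => //.
exact: (continuous_measurable_row (@continuous_enorm n)).
Qed.

End euclidean.

(** * Averaging over dilations *)

Section polar.
Context {R : realType}.
Local Notation mR := (measurableTypeR R).
Local Notation lam := (@lebesgue_measure R).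
Local Notation leb n := (lebesgue_tuple (R := R) n).

Lemma measurable_scale_tuple2 n :
  measurable_fun [set: mR * n.-tuple mR]
    (fun z : mR * n.-tuple mR => scale_tuple z.1 z.2 : n.-tuple mR).
Proof.
apply/measurable_fun_tnthP => i.
rewrite (_ : _ \o _ = (fun z : mR * n.-tuple mR => z.1 * tnth z.2 i)); last first.
  by apply/funext => z /=; rewrite tnth_map.
apply: measurable_funM => //.
by apply: (measurableT_comp (@measurable_tnth _ mR n i)).
Qed.

(** A substitute for polar coordinates that needs no measure on the sphere: K is
    averaged over the dilations t |-> s t, with weights of integral 1 in s.
    After the dilation the weight depends on t only, so that K enters through its
    integrals along rays. *)
Lemma ge0_integral_polar m (K : 'rV[R]_m.+1 -> R) :
  continuous K -> (forall x, 0 <= K x) ->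
  (\int[leb m.+1]_t (K (row_of_tuple t))%:E =
   \int[leb m.+1]_t
     (((enorm (row_of_tuple t))^-1 * expR (- (enorm (row_of_tuple t))^-1))%:E *
      \int[lam]_(s in `]0%R, +oo[) (K (s *: row_of_tuple t) * s ^+ m)%:E))%E.
Proof.
move=> cK K0.
pose P : set mR := `]0, +oo[%classic.
have mP : measurable P by exact: measurable_itv.
pose i : mR -> R := \1_P.
have mi : measurable_fun setT i by exact: measurable_indic.
have i_in s : s \in P -> i s = 1 by move=> sP; rewrite /i indicE sP.
have i_out s : s \notin P -> i s = 0 by move=> sP; rewrite /i indicE (negbTE sP).
have i0 s : 0 <= i s by rewrite /i indicE.
pose a (t : m.+1.-tuple mR) : R := (enorm (row_of_tuple t))^-1.
have a0 t : 0 <= a t by rewrite invr_ge0 enorm_ge0.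
have ma : measurable_fun setT a by exact: measurable_inv_enorm.
have mK : measurable_fun setT (fun t : m.+1.-tuple mR => K (row_of_tuple t)).
  exact: continuous_measurable_row.
(* G carries the weight of rate 1/|t|; H is s^k G(s, s t), its image under the
   dilation. *)
pose G (z : mR * m.+1.-tuple mR) : R :=
  i z.1 * (a z.2 * expR (- (a z.2 * z.1))) * K (row_of_tuple z.2).
pose H (z : mR * m.+1.-tuple mR) : R :=
  i z.1 * (a z.2 * expR (- a z.2)) * (K (z.1 *: row_of_tuple z.2) * z.1 ^+ m).
have mi1 : measurable_fun setT (fun z : mR * m.+1.-tuple mR => i z.1).
  exact: measurableT_comp.
have ma2 : measurable_fun setT (fun z : mR * m.+1.-tuple mR => a z.2).
  exact: measurableT_comp.
have mG : measurable_fun setT G.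
  apply: measurable_funM; last by exact: (measurableT_comp mK).
  apply: measurable_funM => //; apply: measurable_funM => //.
  apply: measurableT_comp => //; apply: measurableT_comp => //.
  exact: measurable_funM.
have mH : measurable_fun setT H.
  apply: measurable_funM.
    apply: measurable_funM => //; apply: measurable_funM => //.
    by apply: measurableT_comp => //; apply: measurableT_comp.
  apply: measurable_funM; last exact: measurable_funX.
  under eq_fun do rewrite -row_of_tupleZ.
  exact: (measurableT_comp mK (@measurable_scale_tuple2 _)).
have mpair (s : mR) :
    measurable_fun [set: m.+1.-tuple mR] (fun t : m.+1.-tuple mR => (s, t)).
  exact: pair1_measurable.
have G0 z : 0 <= G z by rewrite !mulr_ge0 ?expR_ge0.
have H0 z : 0 <= H z.
  have [zP|zP] := boolP (z.1 \in P); last by rewrite /H i_out// !mul0r.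
  have z1 : 0 <= z.1 by move: zP; rewrite inE /P/= in_itv/= andbT => /ltW.
  by rewrite !mulr_ge0 ?expR_ge0 ?exprn_ge0.
transitivity (\int[leb m.+1]_t \int[lam]_s (G (s, t))%:E)%E.
  have mN : measurable [set t : m.+1.-tuple mR | row_of_tuple t = 0].
    rewrite row_of_tuple_eq0.
    by apply: (@measurable_tuple_box _ _ (fun _ => [set 0])) => j.
  rewrite (ge0_negligible_integral mN)//; last 3 first.
  - exact/measurable_EFinP.
  - by move=> t _; rewrite lee_fin.
  - exact: lebesgue_tuple_set0.
  rewrite [RHS](ge0_negligible_integral mN)//; last 3 first.
  - apply: (measurable_fun_fubini_tonelli_G (fun z => (G z)%:E)).
      exact/measurable_EFinP.
    by move=> z; rewrite lee_fin.
  - by move=> t _; apply: integral_ge0 => s _; rewrite lee_fin.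
  - exact: lebesgue_tuple_set0.
  apply: eq_integral => t; rewrite inE /= => -[_ /eqP t0].
  have at0 : 0 < a t by rewrite invr_gt0 enorm_gt0.
  transitivity (\int[lam]_s
      ((K (row_of_tuple t))%:E * ((fun s => (a t * expR (- (a t * s)))%:E) \_ P) s))%E.
    rewrite ge0_integralZl_EFin//; last 2 first.
    - move=> s _; apply: erestrict_ge0 => {}s _.
      by rewrite lee_fin mulr_ge0 ?expR_ge0.
    - apply/(measurable_restrictT _ mP)/measurable_EFinP; apply: measurable_funTS.
      by apply: measurable_funM => //; apply: measurableT_comp => //;
        apply: measurableT_comp => //; exact: measurable_funM.
    - by rewrite -integral_mkcond (exponential_pdf0y at0) mule1.
  apply: eq_integral => s _; rewrite patchE /G/=.
  case: ifPn => sP; first by rewrite i_in// mul1r [in RHS]EFinM muleC.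
  by rewrite i_out// !mul0r mule0.
rewrite -(fubini_tonelli (fun z => (G z)%:E)); last 2 first.
- exact/measurable_EFinP.
- by move=> z; rewrite lee_fin.
transitivity (\int[lam]_s \int[leb m.+1]_t (H (s, t))%:E)%E.
  apply: eq_integral => s _.
  have [sP|sP] := boolP (s \in P); last first.
    by apply: eq_integral => t _; rewrite /G /H/= i_out// !mul0r.
  have s0 : 0 < s by move: sP; rewrite inE /P/= in_itv/= andbT.
  rewrite [LHS](ge0_integral_scale_tuple s0)//; last 2 first.
  - apply/measurable_EFinP.
    exact: (measurableT_comp mG (mpair s)).
  - by move=> t; rewrite lee_fin.
  rewrite -ge0_integralZl_EFin//; last 3 first.
  - by move=> t _; rewrite lee_fin.
  - apply/measurable_EFinP.
    exact: (measurableT_comp mG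
      (measurableT_comp (mpair s) (@measurable_scale_tuple _ m.+1 s))).
  - by rewrite exprn_ge0// ltW.
  apply: eq_integral => t _; rewrite -EFinM; congr EFin.
  rewrite /G /H/= i_in// /a row_of_tupleZ enormZ gtr0_norm// exprS.
  set A := enorm _; rewrite invfM.
  rewrite (_ : s^-1 / A * s = A^-1); last by rewrite mulrAC mulVf ?mul1r ?gt_eqF.
  rewrite -[RHS]mul1r -[X in _ = X * _](mulfV (lt0r_neq0 s0)); ring.
rewrite (fubini_tonelli (fun z => (H z)%:E)); last 2 first.
- exact/measurable_EFinP.
- by move=> z; rewrite lee_fin.
apply: eq_integral => t _.
transitivity (\int[lam]_s ((a t * expR (- (a t)))%:E *
   ((fun s => (K (s *: row_of_tuple t) * s ^+ m)%:E) \_ P) s))%E.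
  apply: eq_integral => s _; rewrite patchE /H/=.
  case: ifPn => sP; first by rewrite i_in// mul1r.
  by rewrite i_out// !mul0r mule0.
rewrite ge0_integralZl_EFin//; last 3 first.
- move=> s _; apply: erestrict_ge0 => {}s; rewrite /P/= in_itv/= andbT => s0.
  by rewrite lee_fin mulr_ge0// exprn_ge0// ltW.
- apply/(measurable_restrictT _ mP)/measurable_EFinP; apply: measurable_funTS.
  apply: measurable_funM; last exact: measurable_funX.
  under eq_fun do rewrite -row_of_tupleZ.
  have mpt : measurable_fun [set: mR] (fun s : mR => (s, t)).
    exact: pair2_measurable.
  exact: (measurableT_comp mK (measurableT_comp (@measurable_scale_tuple2 _) mpt)).
- by rewrite mulr_ge0 ?expR_ge0.
by rewrite -integral_mkcond.
Qed.

End polar.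

(** * Change of variables for radial maps *)

Section change_of_variables.
Context {R : realType}.
Local Notation leb n := (lebesgue_tuple (R := R) n).

(** A radial map preserves each ray, so by [ge0_integral_polar] it suffices to
    compare integrals along a ray, where the Jacobian psi^m f' times s^m is
    exactly what the substitution u = f(s|x|)/|x| of the measure u^m du gives. *)
Lemma integral_radial m (f df psi : R -> R) (F : 'rV[R]_m.+1 -> R) :
  (forall x : R, is_derive x 1 f (df x)) -> continuous df ->
  (forall x, 0 < df x) -> f 0 = 0 -> (forall M, exists x, M <= f x) ->
  (forall s, 0 <= s -> 0 <= psi s) -> (forall s, 0 <= s -> psi s * s = f s) ->
  continuous F -> (forall x, 0 <= F x) ->
  continuous (fun x : 'rV[R]_m.+1 =>
    F (psi (enorm x) *: x) * (psi (enorm x) ^+ m * df (enorm x))) ->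
  (\int[leb m.+1]_t
     (F (psi (enorm (row_of_tuple t)) *: row_of_tuple t) *
      (psi (enorm (row_of_tuple t)) ^+ m * df (enorm (row_of_tuple t))))%:E =
   \int[leb m.+1]_t (F (row_of_tuple t))%:E)%E.
Proof.
move=> fdf cdf df0 f0 foo psi0 psif cF F0 cK.
rewrite (ge0_integral_polar cF F0) (ge0_integral_polar cK); last first.
  by move=> x; rewrite !mulr_ge0 ?exprn_ge0 ?psi0 ?enorm_ge0// ltW.
apply: eq_integral => t _; set x := row_of_tuple t.
have [->|x0] := eqVneq x 0.
  have /eqP -> : enorm (0 : 'rV[R]_m.+1) == 0 by rewrite enorm_eq0.
  by rewrite invr0 !mul0r !mul0e.
congr (_ * _)%E.
have a0 : 0 < enorm x by rewrite enorm_gt0.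
set a := enorm x in a0 *.
have fdfa (s : R) : is_derive s 1 (fun s => f (a * s) / a) (df (a * s)).
  have h1 : is_derive s 1 ( *%R a) a.
    by have := @is_deriveZ R R R id a s 1 1 _; rewrite /GRing.scale/= mulr1; exact.
  have h2 : is_derive s 1 (f \o *%R a) (df (a * s) * a).
    exact: is_derive1_comp.
  rewrite (_ : (fun s => _) = a^-1 *: (f \o *%R a)); last first.
    by apply/funext => y; rewrite mulrC.
  apply: is_derive_eq; rewrite /GRing.scale/= mulrC mulfK// gt_eqF//.
rewrite -(@ge0_integration_by_substitution0y _ (fun s => f (a * s) / a)
  (fun s => df (a * s)) (fun s => F (s *: x) * s ^+ m))//.
- apply: eq_integral => s; rewrite inE/= in_itv/= andbT => s0.
  rewrite enormZ gtr0_norm// -/a -psif ?mulr_ge0 ?(ltW s0) ?(ltW a0)//.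
  rewrite (mulrC s a) scalerA; congr EFin.
  set p := psi _; have -> : p * (a * s) / a = p * s by field; rewrite gt_eqF.
  by rewrite exprMn; ring.
- move=> s; apply: continuous_comp; last exact: cdf.
  exact: mulrl_continuous.
- by rewrite mulr0 f0 mul0r.
- move=> M; have [y My] := foo (M * a); exists (y / a).
  by rewrite ler_pdivlMr// mulrCA mulfV ?mulr1// gt_eqF.
- move=> s; apply: cvgM.
    apply: (@continuous_comp _ _ _ (fun s : R => s *: x) F); last exact: cF.
    exact: scalel_continuous.
  exact: exprn_continuous.
- by move=> s s0; rewrite mulr_ge0// exprn_ge0.
Qed.

End change_of_variables.

(** * The one-dimensional profiles *)

Section calculus.
Context {R : realType}.

Lemma is_derive1P (f : R -> R) (x d : R) :
  (fun h => h^-1 * (f (x + h) - f x)) @ 0^' --> d <-> is_derive x 1 f d.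
Proof.
have E : (fun h => h^-1 * (f (x + h) - f x)) =
    (fun h : R => h^-1 *: ((f \o shift x) (h *: (1 : R)) - f x)).
  by apply/funext => h /=; rewrite /GRing.scale/= mulr1 [x + h]addrC.
rewrite E; split=> [h|[h <-]].
  apply: DeriveDef; last exact: cvg_lim.
  by rewrite /derivable; apply/cvg_ex; exists d.
exact: h.
Qed.

(** Both profiles change formula at a point; the pieces are arbitrary functions
    on the line, compared at the switching point only. *)
Definition switch_at (a : R) (f g : R -> R) (x : R) := if a < x then f x else g x.

Lemma continuous_switch_at (a : R) (f g : R -> R) :
  continuous f -> continuous g -> f a = g a -> continuous (switch_at a f g).
Proof.
move=> cf cg fga x; apply/cvgrPdist_lt => e e0.
have [ax|xa|ax] := ltgtP a x.
- have := cf x => /cvgrPdist_lt /(_ _ e0); rewrite /switch_at ax => fx.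
  near=> y; rewrite ifT; first by near: y.
  by near: y; exact: lt_nbhsr.
- have := cg x => /cvgrPdist_lt /(_ _ e0); rewrite /switch_at (lt_gtF xa) => gx.
  near=> y; rewrite ifF; first by near: y.
  by apply/negbTE; rewrite -leNgt ltW//; near: y; exact: lt_nbhsl.
- rewrite -ax; have := cf a => /cvgrPdist_lt /(_ _ e0) fx.
  have := cg a => /cvgrPdist_lt /(_ _ e0) gx.
  near=> y; rewrite /switch_at ltxx; case: ifPn => _; last by near: y.
  by rewrite -fga; near: y.
Unshelve. all: by end_near. Qed.

Lemma is_derive_switch_at (a : R) (f df g dg : R -> R) :
  (forall x : R, is_derive x 1 f (df x)) ->
  (forall x : R, is_derive x 1 g (dg x)) ->
  f a = g a -> df a = dg a ->
  forall x : R, is_derive x 1 (switch_at a f g) (switch_at a df dg x).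
Proof.
move=> fdf gdg fga dfga x.
have [ax|xa|<-] := ltgtP a x.
- rewrite /switch_at ax; apply: near_eq_is_derive (fdf x).
  near=> y; rewrite ifT//; near: y; exact: lt_nbhsr.
- rewrite /switch_at (lt_gtF xa); apply: near_eq_is_derive (gdg x).
  near=> y; rewrite ifF//; apply/negbTE; rewrite -leNgt ltW//.
  by near: y; exact: lt_nbhsl.
- apply/is_derive1P/cvgrPdist_lt => e e0.
  have /is_derive1P/cvgrPdist_lt/(_ _ e0) fa := fdf a.
  have /is_derive1P/cvgrPdist_lt/(_ _ e0) ga := gdg a.
  near=> y; rewrite /switch_at ltxx; case: ifPn => _; last by near: y.
  by rewrite -fga -dfga; near: y.
Unshelve. all: by end_near. Qed.

(** The positive part of u to the power q.  The switch is needed because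
    u `^ q equals 1 when u is negative. *)
Definition pospow (q u : R) : R := switch_at 0 (fun v => v `^ q) (cst 0) u.

Lemma pospowE q u : 0 < u -> pospow q u = u `^ q.
Proof. by rewrite /pospow /switch_at => ->. Qed.

Lemma pospow_ge0 q u : 0 <= pospow q u.
Proof. by rewrite /pospow /switch_at; case: ifPn => // _; exact: powR_ge0. Qed.

Lemma pospow_le0 q u : u <= 0 -> pospow q u = 0.
Proof. by rewrite /pospow /switch_at leNgt => /negbTE ->. Qed.

Lemma continuous_pospow q : 0 < q -> continuous (pospow q).
Proof.
move=> q0 x; apply/cvgrPdist_lt => e e0.
have [x0|x0|<-] := ltgtP 0 x.
- have : {for x, continuous (fun v : R => v `^ q)}.
    apply: differentiable_continuous; apply/derivable1_diffP.
    exact: (@ex_derive _ _ _ _ _ _ _ (is_derive1_powR q x0)).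
  move/cvgrPdist_lt/(_ _ e0) => fx.
  near=> y; rewrite !pospowE//; first by near: y.
  by near: y; exact: lt_nbhsr.
- near=> y; have y0 : y < 0 by near: y; exact: lt_nbhsl.
  by rewrite (pospow_le0 _ (ltW x0)) (pospow_le0 _ (ltW y0)) subrr normr0.
- have := powR_cvg0 q0 => /cvgrPdist_lt/(_ _ e0)[d /= d0 dP].
  exists d => //= y; rewrite /= (pospow_le0 _ (lexx 0)) => yd.
  have [y0|y0] := ltP 0 y; last by rewrite pospow_le0// subrr normr0.
  by rewrite pospowE//; exact: dP.
Unshelve. all: by end_near. Qed.

Lemma is_derive_pospow q (x : R) : 1 < q ->
  is_derive x 1 (pospow q) (q * pospow (q - 1) x).
Proof.
move=> q1; have [x0|x0|<-] := ltgtP 0 x.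
- rewrite pospowE//.
  apply: near_eq_is_derive (is_derive1_powR q x0).
  by near=> y; rewrite pospowE//; near: y; exact: lt_nbhsr.
- rewrite pospow_le0 ?ltW// mulr0.
  apply: near_eq_is_derive (is_derive_cst 0 x 1).
  by near=> y; rewrite pospow_le0// ltW//; near: y; exact: lt_nbhsl.
  (* The difference quotient at 0 is itself a power, of lower exponent. *)
- rewrite pospow_le0// mulr0; apply/is_derive1P.
  have q0 : 0 < q - 1 by rewrite subr_gt0.
  rewrite -[X in _ --> X](pospow_le0 (q - 1) (lexx 0)).
  have /continuous_withinNx := continuous_pospow q0 (x := 0).
  apply: cvg_trans.
  apply: near_eq_cvg; near=> h.
  have h0 : h != 0 by near: h; exact: nbhs_dnbhs_neq.
  rewrite add0r (pospow_le0 q (lexx 0)) subr0.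
  have [hp|hn] := ltP 0 h; last by rewrite !pospow_le0 ?mulr0.
  by rewrite !pospowE// -[in RHS](@mulr_powRB1 _ h q) ?ltW ?(lt_trans _ q1)// mulKf.
Unshelve. all: by end_near. Qed.

Definition df1 (r p x : R) := 1 + p * pospow (p - 1) (x - r).
Definition ddf1 (r p x : R) := p * (p - 1) * pospow (p - 2) (x - r).

(** The convention 0 `^ p = 0 merges the two cases into one formula that is C^2
    on the line. *)
Lemma f1E (r p : R) : 2 < p -> f1 r p = fun x => x + pospow p (x - r).
Proof.
move=> p2; apply/funext => x; rewrite /f1.
have [xr|xr] := ltP x r; first by rewrite pospow_le0 ?addr0// subr_le0 ltW.
have [->|xr'] := eqVneq x r.
  by rewrite subrr powR0 ?pospow_le0// gt_eqF// (lt_trans _ p2).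
by rewrite pospowE// subr_gt0 lt_neqAle eq_sym xr' xr.
Qed.

Lemma is_derive_pospow_shift q (r x : R) : 1 < q ->
  is_derive x 1 (fun x => pospow q (x - r)) (q * pospow (q - 1) (x - r)).
Proof.
move=> q1; have h1 : is_derive x 1 (fun x : R => x - r) 1.
  by rewrite -[X in is_derive _ _ _ X]subr0; exact: is_deriveB.
have h2 : is_derive (x - r) 1 (pospow q) (q * pospow (q - 1) (x - r)).
  exact: is_derive_pospow.
by have := @is_derive1_comp _ (pospow q) (fun x => x - r) x _ _ h2 h1; rewrite mulr1.
Qed.

Lemma is_derive_f1 (r p x : R) : 2 < p -> is_derive x 1 (f1 r p) (df1 r p x).
Proof.
move=> p2; rewrite f1E//.
have p1 : 1 < p by rewrite (lt_trans _ p2)// ltr1n.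
exact: (is_deriveD (is_derive_id x 1) (is_derive_pospow_shift r x p1)).
Qed.

Lemma is_derive_df1 (r p x : R) : 2 < p -> is_derive x 1 (df1 r p) (ddf1 r p x).
Proof.
move=> p2; have p1 : 1 < p - 1 by lra.
rewrite (_ : df1 r p = cst 1 + p *: (fun x => pospow (p - 1) (x - r)))//.
have h := is_deriveD (is_derive_cst (1 : R) x 1)
  (is_deriveZ p (is_derive_pospow_shift r x p1)).
rewrite add0r in h; apply: is_derive_eq h _.
rewrite /ddf1 /GRing.scale/= mulrA; congr (_ * pospow _ _); lra.
Qed.

Lemma continuous_ddf1 (r p : R) : 2 < p -> continuous (ddf1 r p).
Proof.
move=> p2 x; apply: cvgM; first exact: cvg_cst.
apply: (@continuous_comp _ _ _ (fun x : R => x - r) (pospow (p - 2))).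
  by apply: cvgB; [exact: cvg_id|exact: cvg_cst].
by apply: continuous_pospow; lra.
Qed.

Lemma is_derive_cubic (c d x : R) :
  is_derive x 1 (fun x => x ^+ 3 * c + x * d) (x ^+ 2 * (3 * c) + d).
Proof.
rewrite (_ : (fun x => _) = c *: ((@id R) ^+ 3) + d *: (@id R)); last first.
  by apply/funext => y; rewrite /GRing.scale/= mulrC [y * _]mulrC.
apply: is_derive_eq; rewrite /GRing.scale/=; ring.
Qed.

Lemma is_derive_quadratic (c d x : R) :
  is_derive x 1 (fun x => x ^+ 2 * c + d) (x * (2 * c)).
Proof.
rewrite (_ : (fun x => _) = c *: ((@id R) ^+ 2) + cst d); last first.
  by apply/funext => y; rewrite /GRing.scale/= mulrC.
apply: is_derive_eq; rewrite /GRing.scale/=; ring.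
Qed.

Lemma is_derive_expRM (b c d x : R) :
  is_derive x 1 (fun x => c * expR (b * x) + d) (c * b * expR (b * x)).
Proof.
have h1 : is_derive x 1 ( *%R b) b.
  by have := @is_deriveZ R R R id b x 1 1 _; rewrite /GRing.scale/= mulr1; exact.
have h2 := @is_derive1_comp _ expR ( *%R b) x _ _ (is_derive_expR (b * x)) h1.
rewrite (_ : (fun x => _) = c *: (expR \o *%R b) + cst d)//.
apply: is_derive_eq; rewrite /GRing.scale/=; ring.
Qed.

Definition df2 (b : R) : R -> R := switch_at b^-1 (fun x => b * expR (b * x))
  (fun x => x ^+ 2 * (b ^+ 3 * expR 1 / 2) + b * expR 1 / 2).

Definition ddf2 (b : R) : R -> R := switch_at b^-1 (fun x => b ^+ 2 * expR (b * x))
  (fun x => x * (b ^+ 3 * expR 1)).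

Lemma is_derive_f2 (b x : R) : 0 < b -> is_derive x 1 (f2 b) (df2 b x).
Proof.
move=> b0; have bN0 : b != 0 by rewrite gt_eqF.
apply: is_derive_switch_at => [y|y||].
- have := is_derive_expRM b 1 (- (expR 1 / 3)) y; rewrite mul1r.
  by congr is_derive; apply/funext => z; rewrite mul1r.
- by apply: is_derive_eq (is_derive_cubic _ _ _) _; field.
- by rewrite mulfV//; field.
- by rewrite mulfV//; field.
Qed.

Lemma is_derive_df2 (b x : R) : 0 < b -> is_derive x 1 (df2 b) (ddf2 b x).
Proof.
move=> b0; have bN0 : b != 0 by rewrite gt_eqF.
apply: is_derive_switch_at => [y|y||].
- have := is_derive_expRM b b 0 y; rewrite -expr2.
  by congr is_derive; apply/funext => z; rewrite addr0.
- by apply: is_derive_eq (is_derive_quadratic _ _ _) _; field.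
- by rewrite mulfV//; field.
- by rewrite mulfV//; field.
Qed.

Lemma continuous_ddf2 (b : R) : 0 < b -> continuous (ddf2 b).
Proof.
move=> b0; have bN0 : b != 0 by rewrite gt_eqF.
apply: continuous_switch_at => [x|x|].
- apply: cvgM; first exact: cvg_cst.
  by apply: continuous_comp; [exact: mulrl_continuous|exact: continuous_expR].
- exact: mulrr_continuous.
- by rewrite mulfV//; field.
Qed.

Lemma df1_ge1 (r p x : R) : 2 < p -> 1 <= df1 r p x.
Proof.
by move=> p2; rewrite /df1 lerDl mulr_ge0 ?pospow_ge0// (le_trans _ (ltW p2)).
Qed.

Lemma df2_gt0 (b x : R) : 0 < b -> 0 < df2 b x.
Proof.
move=> b0; rewrite /df2 /switch_at; case: ifPn => _.
  by rewrite mulr_gt0// expR_gt0.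
rewrite ltr_wpDl//; last by rewrite !mulr_gt0 ?expR_gt0.
by rewrite mulr_ge0 ?sqr_ge0// !mulr_ge0 ?exprn_ge0 ?expR_ge0// ltW.
Qed.

Definition f12 (r p b : R) : R -> R := f2 b \o f1 r p.
Definition df12 (r p b x : R) := df2 b (f1 r p x) * df1 r p x.
Definition ddf12 (r p b x : R) :=
  ddf2 b (f1 r p x) * df1 r p x ^+ 2 + df2 b (f1 r p x) * ddf1 r p x.

Lemma is_derive_f12 (r p b x : R) : 2 < p -> 0 < b ->
  is_derive x 1 (f12 r p b) (df12 r p b x).
Proof.
move=> p2 b0; apply: is_derive1_comp; first exact: is_derive_f2.
exact: is_derive_f1.
Qed.

Lemma is_derive_df12 (r p b x : R) : 2 < p -> 0 < b ->
  is_derive x 1 (df12 r p b) (ddf12 r p b x).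
Proof.
move=> p2 b0; have h1 := @is_derive1_comp _ (df2 b) (f1 r p) x _ _
  (is_derive_df2 _ b0) (is_derive_f1 _ _ p2).
have := is_deriveM h1 (is_derive_df1 r x p2).
rewrite /ddf12 /GRing.scale/=; congr is_derive; ring.
Qed.

Lemma continuous_ddf12 (r p b : R) : 2 < p -> 0 < b -> continuous (ddf12 r p b).
Proof.
move=> p2 b0.
have cf1 : continuous (f1 r p).
  by apply: (@is_derive_continuous _ _ (df1 r p)) => y; exact: is_derive_f1.
have cdf1 : continuous (df1 r p).
  by apply: (@is_derive_continuous _ _ (ddf1 r p)) => y; exact: is_derive_df1.
have cdf2 : continuous (df2 b).
  by apply: (@is_derive_continuous _ _ (ddf2 b)) => y; exact: is_derive_df2.
move=> x; apply: cvgD; apply: cvgM.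
- apply: (@continuous_comp _ _ _ (f1 r p) (ddf2 b)); first exact: cf1.
  exact: continuous_ddf2.
- apply: (@continuous_comp _ _ _ (df1 r p) (fun y => y ^+ 2)); first exact: cdf1.
  exact: exprn_continuous.
- by apply: (@continuous_comp _ _ _ (f1 r p) (df2 b)); [exact: cf1|exact: cdf2].
- exact: continuous_ddf1.
Qed.

Lemma f1_0 (r p : R) : 0 <= r -> 2 < p -> f1 r p 0 = 0.
Proof. by move=> r0 p2; rewrite f1E// pospow_le0 ?addr0// sub0r oppr_le0. Qed.

Lemma f2_0 (b : R) : 0 < b -> f2 b 0 = 0.
Proof.
move=> b0; rewrite /f2 ifF; first by rewrite expr0n/= !mul0r addr0.
by apply/negbTE; rewrite -leNgt invr_ge0 ltW.
Qed.

Lemma ddf12_0 (r p b : R) : 0 <= r -> 2 < p -> 0 < b -> ddf12 r p b 0 = 0.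
Proof.
move=> r0 p2 b0; rewrite /ddf12 f1_0// /ddf1 pospow_le0 ?sub0r ?oppr_le0//.
rewrite /ddf2 /switch_at ifF; last by apply/negbTE; rewrite -leNgt invr_ge0 ltW.
by rewrite !(mul0r, mulr0) addr0.
Qed.

Lemma df12_gt0 (r p b x : R) : 2 < p -> 0 < b -> 0 < df12 r p b x.
Proof.
by move=> p2 b0; rewrite mulr_gt0 ?df2_gt0// (lt_le_trans _ (df1_ge1 _ _ p2)).
Qed.

Lemma f12_unbounded (r p b : R) : 2 < p -> 0 < b ->
  forall M, exists x, M <= f12 r p b x.
Proof.
move=> p2 b0 M; exists (Num.max (b^-1 + 1) ((`|M| + expR 1 / 3) / b)).
set x := Num.max _ _.
have xf1 : x <= f1 r p x by rewrite f1E// lerDl pospow_ge0.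
have x1 : b^-1 < x by rewrite lt_max ltrDl ltr01.
rewrite /f12/= /f2 ifT ?(lt_le_trans x1)// lerBrDr.
apply: (@le_trans _ _ (b * x)).
  apply: (@le_trans _ _ (`|M| + expR 1 / 3)); first by rewrite lerD2r ler_norm.
  by rewrite -ler_pdivrMl// mulrC le_max lexx orbT.
apply: (@le_trans _ _ (b * f1 r p x)); first by rewrite ler_pM2l.
by apply: (le_trans _ (expR_ge1Dx _)); rewrite lerDr.
Qed.

End calculus.

(** * The quotient of a profile by its variable *)

Section quotient.
Context {R : realType}.

Lemma is_derive_lipschitz (g dg : R -> R) (M s : R) :
  (forall x : R, is_derive x 1 g (dg x)) ->
  (forall x, `|x| <= `|s| -> `|dg x| <= M) -> `|g s - g 0| <= M * `|s|.
Proof.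
move=> gdg dgM.
have cg D : {within D, continuous g}.
  by apply: continuous_subspaceT; exact: is_derive_continuous gdg.
have [s0|s0] := leP 0 s.
  have [c] := MVT_segment s0 (fun x _ => gdg x) (cg _).
  rewrite in_itv/= => /andP[c0 cs] ->; rewrite subr0 normrM.
  by rewrite ler_wpM2r// dgM// !ger0_norm.
have [c] := MVT_segment (ltW s0) (fun x _ => gdg x) (cg _).
rewrite in_itv/= => /andP[c0 cs] e; rewrite distrC e sub0r normrM normrN.
by rewrite ler_wpM2r// dgM// !ler0_norm ?lerN2// ltW.
Qed.

Variables f df ddf : R -> R.
Hypothesis fdf : forall x : R, is_derive x 1 f (df x).
Hypothesis dfddf : forall x : R, is_derive x 1 df (ddf x).
Hypothesis cddf : continuous ddf.
Hypothesis f0 : f 0 = 0.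
Hypothesis ddf0 : ddf 0 = 0.

(** The value at 0 is the limit of f(s) / s when f(0) = 0. *)
Definition quot s := if s == 0 then df 0 else f s / s.
(** This is also correct at s = 0, where 0^-1 = 0 makes it vanish: the
    derivative of the quotient at 0 is f''(0) / 2, and f''(0) = 0 below. *)
Definition dquot s := (df s - quot s) / s.

Lemma quotK s : quot s * s = f s.
Proof. by rewrite /quot; case: eqVneq => [->|s0]; rewrite ?mulr0 ?f0// divfK. Qed.

Lemma dquotK s : quot s + s * dquot s = df s.
Proof.
rewrite /dquot; have [->|s0] := eqVneq s 0.
  by rewrite mul0r addr0 /quot eqxx.
by field.
Qed.

Lemma dquot0 : dquot 0 = 0.
Proof. by rewrite /dquot invr0 mulr0. Qed.

(** The mean value theorem is applied twice: f'' = o(1) gives f'(s) - f'(0) =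
    o(s), which in turn gives f(s) - f'(0) s = o(s^2). *)
Lemma quot_second_order e : 0 < e -> \forall s \near 0,
  `|df s - df 0| <= e * `|s| /\ `|quot s - df 0| <= e * `|s|.
Proof.
move=> e0; have := @cddf 0 => /cvgrPdist_le/(_ _ e0).
rewrite ddf0 => -[d /= d0 dP]; exists d => //= s; rewrite /= sub0r normrN => sd.
have H1 x : `|x| <= `|s| -> `|df x - df 0| <= e * `|x|.
  move=> xs; apply: (is_derive_lipschitz dfddf) => y yx.
  have := dP y; rewrite /= !sub0r !normrN; apply.
  exact: le_lt_trans yx (le_lt_trans xs sd).
split; first exact: H1.
have [->|s0] := eqVneq s 0; first by rewrite /quot eqxx subrr !normr0 mulr0.
have gdg (x : R) : is_derive x 1 (fun y => f y - df 0 * y) (df x - df 0).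
  have := is_deriveB (fdf x) (is_deriveZ (df 0) (is_derive_id x (1 : R))).
  by rewrite /GRing.scale/= mulr1.
have := @is_derive_lipschitz _ _ (e * `|s|) s gdg.
rewrite f0 mulr0 !subr0 => /(_ _)/le_trans.
have -> : quot s - df 0 = (f s - df 0 * s) / s.
  by rewrite /quot (negbTE s0); field.
rewrite normrM normfV ler_pdivrMr ?normr_gt0//; apply => // x xs.
by apply: (le_trans (H1 _ xs)); rewrite ler_pM2l.
Qed.

Lemma is_derive_quot (s : R) : is_derive s 1 quot (dquot s).
Proof.
have [->|s0] := eqVneq s 0.
  rewrite dquot0; apply/is_derive1P/cvgrPdist_le => e e0.
  have [d /= d0 dP] := quot_second_order e0.
  exists d => //= h hd h0; rewrite sub0r normrN add0r.
  rewrite {2}/quot eqxx normrM normfV ler_pdivrMl ?normr_gt0// mulrC.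
  by have [] := dP h hd.
have h1 := @is_deriveV _ id s 1 1 s0 (is_derive_id s 1).
have h2 := is_deriveM (fdf s) h1.
have h3 : is_derive s 1 (fun y => f y * y^-1) (dquot s).
  apply: is_derive_eq h2 _; rewrite /dquot /quot (negbTE s0) /GRing.scale/=.
  by field.
apply: near_eq_is_derive h3; near=> y.
have y0 : y != 0 by near: y; apply: open_nbhs_nbhs; split=> //; exact: open_neq.
by rewrite /quot (negbTE y0).
Unshelve. all: by end_near. Qed.

Lemma continuous_dquot : continuous dquot.
Proof.
move=> s; have [->|s0] := eqVneq s 0.
  apply/cvgrPdist_le => e e0; rewrite dquot0.
  have e20 : 0 < e / 2 by rewrite divr_gt0.
  near=> x; rewrite sub0r normrN /dquot normrM normfV.
  have [->|x0] := eqVneq x 0; first by rewrite normr0 invr0 mulr0 ltW.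
  rewrite ler_pdivrMr ?normr_gt0//.
  have [h1 h2] : `|df x - df 0| <= e / 2 * `|x| /\ `|quot x - df 0| <= e / 2 * `|x|.
    by near: x; exact: quot_second_order.
  rewrite (_ : df x - quot x = (df x - df 0) - (quot x - df 0)); last by ring.
  by apply: (le_trans (ler_normB _ _)); lra.
apply: cvgM; last exact: cvgV.
apply: cvgB; first exact: (is_derive_continuous dfddf).
exact: (is_derive_continuous is_derive_quot).
Unshelve. all: by end_near. Qed.

End quotient.

(** * Differentiability of functions of the Euclidean norm *)

Section differential.
Context {R : realType}.

Lemma is_diff_eps (V W : normedModType R) (f : V -> W) (df : {linear V -> W}) x :
  continuous df ->
  (forall e, 0 < e -> \forall h \near 0, `|f (h + x) - f x - df h| <= e * `|h|) ->
  is_diff x f df.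
Proof.
move=> cdf feps.
have E : f \o shift x = cst (f x) + df +o_ 0 id.
  apply/eqaddoP => e e0; near=> h.
  have -> : (f \o shift x - (cst (f x) + df)) h = f (h + x) - f x - df h.
    by rewrite /= !fctE /cst opprD addrA.
  by near: h; exact: feps.
have D := diff_unique cdf E.
by apply: DiffDef => //; apply/diff_locallyP; rewrite D.
Unshelve. all: by end_near. Qed.

Lemma is_derive1_diff (f : R -> R) (x d : R) :
  is_derive x 1 f d -> is_diff x f (fun h => h * d).
Proof.
move=> [fx <-]; have df : differentiable f x by exact/derivable1_diffP.
by apply: DiffDef => //; rewrite diff1E// derive1E.
Qed.

Variable n : nat.
Implicit Types u v w x : 'rV[R]_n.

Lemma dotvC u v : dotv u v = dotv v u.
Proof. by apply: eq_bigr => i _; rewrite mulrC. Qed.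

Lemma dotv_is_linear u : linear (dotv u).
Proof.
move=> a v w; rewrite /dotv /GRing.scale/= mulr_sumr -big_split/=.
by apply: eq_bigr => i _; rewrite !mxE; ring.
Qed.

HB.instance Definition _ u :=
  GRing.isLinear.Build R 'rV[R]_n R _ (dotv u) (dotv_is_linear u).

Lemma dotvZr c u v : dotv u (c *: v) = c * dotv u v.
Proof. by rewrite linearZ. Qed.

Lemma dotvZl c u v : dotv (c *: u) v = c * dotv u v.
Proof. by rewrite dotvC dotvZr dotvC. Qed.

Lemma dotvDr u v w : dotv u (v + w) = dotv u v + dotv u w.
Proof. by rewrite linearD. Qed.

Lemma dotvDl u v w : dotv (u + v) w = dotv u w + dotv v w.
Proof. by rewrite dotvC dotvDr ![dotv w _]dotvC. Qed.

Lemma continuous_dotvr u : continuous (dotv u).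
Proof.
by apply: (@continuous_dotv _ _ (cst u) id) => x; [exact: cst_continuous|exact: cvg_id].
Qed.

Lemma normr_coord x i : `|x 0 i| <= `|x|.
Proof.
rewrite [leRHS]mx_normrE; exact: (le_bigmax _ (fun ij => `|x ij.1 ij.2|) (0, i)).
Qed.

Lemma dotvv_le x : dotv x x <= n%:R * `|x| ^+ 2.
Proof.
apply: (@le_trans _ _ (\sum_(i < n) `|x| ^+ 2)).
  apply: ler_sum => i _; rewrite -expr2 -[leLHS]real_normK ?num_real//.
  by rewrite lerXn2r ?nnegrE ?normr_ge0// normr_coord.
by rewrite sumr_const card_ord mulr_natl.
Qed.

Lemma enorm_le x : enorm x <= Num.sqrt n%:R * `|x|.
Proof.
rewrite -[`|x|]ger0_norm// -sqrtr_sqr -sqrtrM// ler_sqrt ?dotvv_le//.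
Qed.

Lemma is_diff_dotvv x : is_diff x (fun y => dotv y y) (dotv (2 *: x)).
Proof.
apply: is_diff_eps; first exact: continuous_dotvr.
move=> e e0; apply/nbhs_norm0P; exists (e / n.+1%:R) => /=; first by rewrite divr_gt0.
move=> h /= he.
rewrite (_ : _ - _ - _ = dotv h h); last first.
  rewrite /dotv -!sumrB; apply: eq_bigr => i _; rewrite !mxE; ring.
rewrite ger0_norm ?dotvv_ge0// (le_trans (dotvv_le _))//.
rewrite expr2 mulrA ler_wpM2r//.
apply: (@le_trans _ _ (n.+1%:R * (e / n.+1%:R))).
  by rewrite ler_pM// ?ler_nat// ltW.
by rewrite mulrC divfK.
Qed.

Lemma is_diff_enorm x : x != 0 -> is_diff x (@enorm R n) (dotv (dirv x)).
Proof.
move=> x0; have xx : 0 < dotv x x by rewrite -sqr_enorm exprn_gt0// enorm_gt0.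
have h1 := is_derive1_diff (is_derive1_sqrt xx).
have h2 := is_diff_dotvv x.
have := is_diff_comp h2 h1.
congr is_diff_def; apply/funext => v /=; rewrite -/(enorm x) /dirv.
rewrite !dotvZl.
by field; rewrite gt_eqF// enorm_gt0.
Qed.

(** The Euclidean norm is not differentiable at 0, but q(|x|) is: since q'(0) = 0,
    q(|x|) - q(0) = o(|x|), and |x| is bounded by a multiple of the sup norm. *)
Lemma is_diff_radial_fun (q dq : R -> R) x :
  (forall s : R, is_derive s 1 q (dq s)) -> dq 0 = 0 ->
  is_diff x (q \o @enorm R n) (dotv (dq (enorm x) *: dirv x)).
Proof.
move=> qdq dq0; have [->|x0] := eqVneq x 0; last first.
  have := is_diff_comp (is_diff_enorm x0) (is_derive1_diff (qdq (enorm x))).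
  congr is_diff_def; apply/funext => v /=.
  by rewrite dotvZl mulrC.
have en0 : enorm (0 : 'rV[R]_n) = 0 by apply/eqP; rewrite enorm_eq0.
rewrite en0 dq0 scale0r.
apply: is_diff_eps; first exact: continuous_dotvr.
move=> e e0; pose C : R := Num.sqrt n%:R + 1.
have C0 : 0 < C by rewrite ltr_wpDl ?sqrtr_ge0.
have /is_derive1P/cvgrPdist_le/(_ (e / C)) := qdq 0.
rewrite dq0 divr_gt0// => /(_ isT)[d /= d0 dP].
apply/nbhs_norm0P; exists (d / C) => /=; first by rewrite divr_gt0.
move=> h /= hd.
rewrite dotvC linear0 subr0 addr0 en0.
have hC : enorm h <= C * `|h|.
  by rewrite (le_trans (enorm_le _))// ler_wpM2r// lerDl.
have [->|h0] := eqVneq h 0; first by rewrite en0 subrr !normr0 mulr0.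
have eh0 : 0 < enorm h by rewrite enorm_gt0.
have := dP (enorm h); rewrite /= !sub0r !normrN add0r (gtr0_norm eh0) gt_eqF//.
rewrite normrM normfV (gtr0_norm eh0) ler_pdivrMl// => /(_ _ isT)/le_trans; apply.
  by rewrite (le_lt_trans hC)// -ltr_pdivlMl// mulrC.
by rewrite mulrC -mulrA ler_pM2l// ler_pdivrMl.
Qed.

End differential.

(** * Gradients, radial vector fields and rank-one determinants *)

Section vector_fields.
Context {R : realType}.

(** Scalar multiplication is a continuous bilinear map, which yields the product
    rule for a scalar function times a vector function. *)
Lemma scale_is_bilinear (V : normedModType R) :
  bilinear_for
    (GRing.Scale.Law.clone _ _ *:%R _) (GRing.Scale.Law.clone _ _ *:%R _)
    (@GRing.scale R V).
Proof.
split=> [u'|u] a x y /=.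
- by rewrite scalerDl -scalerA.
- by rewrite scalerDr !scalerA mulrC.
Qed.
HB.instance Definition _ (V : normedModType R) :=
  bilinear_isBilinear.Build R R V V _ _ (@GRing.scale R V) (scale_is_bilinear V).

Lemma is_diff_scale (V W : normedModType R) (k dk : V -> R) (f df : V -> W) x :
  is_diff x k dk -> is_diff x f df ->
  is_diff x (fun y => k y *: f y) (fun v => k x *: df v + dk v *: f x).
Proof.
move=> hk hf.
pose s : {bilinear R -> W -> W} := @GRing.scale R W.
have cs : continuous (fun p : R * W => s p.1 p.2) by exact: scale_continuous.
have hs : is_diff (k x, f x) (fun p : R * W => s p.1 p.2)
    (fun q => s (k x) q.2 + s q.1 (f x)).
  by apply: DiffDef; [exact: differentiable_bilin|rewrite diff_bilin].
exact: (is_diff_comp (is_diff_pair hk hf) hs).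
Qed.

(** The matrix is the Schur complement of the lower right corner of a bordered
    matrix; eliminating the other diagonal block instead leaves the scalar
    1 + a^-1 (u . v). *)
Lemma det_scalar_rank1 m (a : R) (u v : 'rV[R]_m.+1) : a != 0 ->
  \det (a%:M + u^T *m v) = a ^+ m * (a + dotv u v).
Proof.
move=> a0.
have E : block_mx (a%:M + u^T *m v) u^T 0 (1%:M : 'M[R]_1) *m block_mx 1%:M 0 (- v) 1%:M =
    block_mx (a%:M : 'M[R]_m.+1) 0 (- v) (1%:M + v *m (a^-1 *: u^T)) *m
    block_mx 1%:M (a^-1 *: u^T) 0 (1%:M : 'M[R]_1).
  rewrite !mulmx_block !(mul0mx, mulmx0, mul1mx, mulmx1, addr0, add0r, mulmxN).
  rewrite addrK mul_scalar_mx scalerA mulfV// scale1r.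
  by rewrite mulNmx addrC addrK.
have := congr1 determinant E.
rewrite !det_mulmx !(det_ublock, det_lblock) !det1 !mulr1 => ->.
rewrite det_scalar exprSr -mulrA; congr (_ * _).
rewrite [X in \det X]mx11_scalar det_scalar1 !mxE eqxx mulrDr mulr1; congr (_ + _).
rewrite mulr_sumr; apply: eq_bigr => i _; rewrite !mxE.
by field.
Qed.

Lemma differentiable_is_diff_grad n (f : 'rV[R]_n -> R) x :
  differentiable f x -> is_diff x f (dotv (grad f x)).
Proof.
move=> fx; apply: DiffDef => //; apply/funext => v.
rewrite {1}(row_sum_delta v) linear_sum/= /dotv.
apply: eq_bigr => i _; rewrite linearZ/= mxE deriveE// mulrC.
by [].
Qed.

Lemma is_diff_gradE n (f : 'rV[R]_n -> R) x g : is_diff x f (dotv g) -> grad f x = g.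
Proof.
move=> h; apply/rowP => i; rewrite mxE deriveE; last exact: ex_diff.
rewrite (diff_val (is_diff_def := h)) /dotv (bigD1 i)//= big1 ?addr0.
  by rewrite !mxE !eqxx mulr1.
by move=> j ji; rewrite !mxE (negbTE ji) andbF mulr0.
Qed.

Lemma mx_norm_le_enorm n (x : 'rV[R]_n) : `|x| <= enorm x.
Proof.
rewrite [leLHS]mx_normrE; apply/bigmax_leP; split=> [|[i j] _ /=]; first exact: enorm_ge0.
rewrite (ord1 i) -sqrtr_sqr ler_sqrt ?dotvv_ge0// /dotv (bigD1 j)//= -expr2 lerDl.
by apply: sumr_ge0 => l _; rewrite -expr2 sqr_ge0.
Qed.

(** The direction x/|x| jumps at 0 but stays bounded, and its factor vanishes
    there. *)
Lemma continuous_radial_field n (q : R -> R) : continuous q -> q 0 = 0 ->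
  continuous (fun x : 'rV[R]_n => q (enorm x) *: dirv x).
Proof.
move=> cq q0 x.
have cqe : {for x, continuous (fun y : 'rV[R]_n => q (enorm y))}.
  by apply: (@continuous_comp _ _ _ (@enorm R n) q); [exact: continuous_enorm|exact: cq].
have [x0|x0] := eqVneq x 0; last first.
  have cd : {for x, continuous (@dirv R n)}.
    apply: (@continuousZ _ _ _ (fun y => (enorm y)^-1) id x); last exact: cvg_id.
    apply: (@continuousV _ _ (@enorm R n)); last exact: continuous_enorm.
    by rewrite enorm_eq0.
  exact: (@continuousZ _ _ _ (fun y => q (enorm y)) (@dirv R n) x).
have e0 : enorm x = 0 by apply/eqP; rewrite x0 enorm_eq0.
rewrite /continuous_at e0 q0 scale0r.
apply/(@cvgr0Pnorm_le R 'rV[R]_n 'rV[R]_n (nbhs x) (nbhs_filter x)) => e ep.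
move/cvgrPdist_le : cqe => /(_ e ep); rewrite e0 q0; apply: filterS => y.
rewrite sub0r normrN; apply: le_trans; rewrite normrZ ler_piMr//.
rewrite /dirv normrZ normfV (ger0_norm (enorm_ge0 _)).
have [y0|y0] := eqVneq (enorm y) 0; first by rewrite y0 invr0 mul0r.
by rewrite ler_pdivrMl ?mulr1 ?mx_norm_le_enorm// enorm_gt0 -enorm_eq0.
Qed.

Lemma dotv_dirv n (x : 'rV[R]_n) : dotv (dirv x) x = enorm x.
Proof.
rewrite dotvZl -sqr_enorm; have [->|x0] := eqVneq (enorm x) 0.
  by rewrite invr0 mul0r.
by rewrite expr2 mulKf.
Qed.

Lemma grad_ln n (g : 'rV[R]_n -> R) y : differentiable g y -> 0 < g y ->
  grad (@ln R \o g) y = (g y)^-1 *: grad g y.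
Proof.
move=> dg g0; apply: is_diff_gradE.
have := is_diff_comp (differentiable_is_diff_grad dg)
  (is_derive1_diff (is_derive1_ln g0)).
by congr is_diff_def; apply/funext => v /=; rewrite dotvZl mulrC.
Qed.

End vector_fields.

(** * The density transformed by a radial map *)

Section radial.
Context {R : realType} (m : nat).
Variables f df ddf : R -> R.
Hypothesis fdf : forall x : R, is_derive x 1 f (df x).
Hypothesis dfddf : forall x : R, is_derive x 1 df (ddf x).
Hypothesis cddf : continuous ddf.
Hypothesis f0 : f 0 = 0.
Hypothesis ddf0 : ddf 0 = 0.
Hypothesis df_gt0 : forall x, 0 < df x.

Local Notation psi := (quot f df).
Local Notation dpsi := (dquot f df).
Local Notation h := (radial (k := m.+1) f).
Implicit Types x v : 'rV[R]_m.+1.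

Let psidpsi (s : R) : is_derive s 1 psi (dpsi s).
Proof. exact: is_derive_quot fdf dfddf cddf f0 ddf0 s. Qed.

Lemma quot_gt0 s : 0 <= s -> 0 < psi s.
Proof.
rewrite le_eqVlt => /predU1P[<-|s0]; first by rewrite /quot eqxx.
by rewrite /quot gt_eqF// divr_gt0// -f0; exact: (gt0_is_derive_lt fdf).
Qed.

Lemma radialE x : h x = psi (enorm x) *: x.
Proof.
rewrite /radial /quot enorm_eq0; case: ifPn => // /eqP ->; by rewrite scaler0.
Qed.

Lemma enorm_radial x : enorm (h x) = f (enorm x).
Proof.
by rewrite radialE enormZ gtr0_norm ?quot_gt0 ?enorm_ge0// (quotK df f0).
Qed.

Lemma dirv_radial x : dirv (h x) = dirv x.
Proof.
rewrite /dirv enorm_radial -(quotK df f0) radialE scalerA invfM mulrAC.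
by rewrite mulVf ?mul1r// gt_eqF// quot_gt0// enorm_ge0.
Qed.

(** The gradient of psi(|x|). *)
Definition radial_field x := dpsi (enorm x) *: dirv x.

Lemma is_diff_radial x : is_diff x h
  (fun v => psi (enorm x) *: v + dotv (radial_field x) v *: x).
Proof.
rewrite (_ : h = (fun y => (psi \o @enorm R m.+1) y *: id y)); last first.
  by apply/funext => y; exact: radialE.
apply: is_diff_scale.
exact: (is_diff_radial_fun x psidpsi (dquot0 f df)).
Qed.

(** The identity psi + s psi' = f', obtained by differentiating f = s psi. *)
Lemma dotv_radial_field x : psi (enorm x) + dotv (radial_field x) x = df (enorm x).
Proof. by rewrite /radial_field dotvZl dotv_dirv mulrC dquotK. Qed.

Definition radial_jac (s : R) := psi s ^+ m * df s.

Definition dradial_jac (s : R) :=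
  psi s ^+ m * ddf s + df s * (m%:R * psi s ^+ m.-1 * dpsi s).

Lemma radial_jac_gt0 s : 0 <= s -> 0 < radial_jac s.
Proof. by move=> s0; rewrite mulr_gt0// exprn_gt0// quot_gt0. Qed.

(** By the product rule the Jacobian is psi plus the rank-one matrix built from x
    and the gradient of psi(|x|), so its eigenvalues are psi in the directions
    orthogonal to x and psi + s psi' = f' in the radial direction. *)
Lemma det_jacobian_radial x : \det ('J h x) = radial_jac (enorm x).
Proof.
rewrite /radial_jac -dotv_radial_field -det_scalar_rank1 ?gt_eqF ?quot_gt0 ?enorm_ge0//.
congr determinant; apply/matrixP => i j.
rewrite /jacobian mxE (diff_val (is_diff_def := is_diff_radial x)) !mxE big_ord1 !mxE.
congr (_ + _); first by rewrite eqxx/= mulr_natr eq_sym.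
congr (_ * _); rewrite /dotv (bigD1 i)//= big1 ?addr0.
  by rewrite !mxE !eqxx mulr1.
by move=> l li; rewrite !mxE (negbTE li) andbF mulr0.
Qed.

Lemma transformedE pi x : transformed h pi x = pi (h x) * radial_jac (enorm x).
Proof.
by rewrite /transformed det_jacobian_radial ger0_norm// ltW// radial_jac_gt0// enorm_ge0.
Qed.

Lemma is_derive_radial_jac (s : R) : is_derive s 1 radial_jac (dradial_jac s).
Proof.
rewrite (_ : radial_jac = psi ^+ m * df); last first.
  by apply/funext => y; rewrite !fctE.
apply: is_derive_eq (is_deriveM (is_deriveX m (psidpsi s)) (dfddf s)) _.
by rewrite !fctE /GRing.scale.
Qed.

Lemma dradial_jac0 : dradial_jac 0 = 0.
Proof. by rewrite /dradial_jac ddf0 dquot0 !mulr0 addr0. Qed.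

Lemma continuous_quot : continuous psi.
Proof. exact: is_derive_continuous psidpsi. Qed.

Lemma continuous_dradial_jac : continuous dradial_jac.
Proof.
have cp l : continuous (fun s => psi s ^+ l).
  move=> s; apply: (@continuous_comp _ _ _ psi (fun y => y ^+ l)).
    exact: continuous_quot.
  exact: exprn_continuous.
move=> s; apply: cvgD; apply: cvgM.
- exact: cp.
- exact: cddf.
- exact: (is_derive_continuous dfddf).
- apply: cvgM; last exact: continuous_dquot fdf dfddf cddf f0 ddf0 s.
  by apply: cvgM; [exact: cvg_cst|exact: cp].
Qed.

Lemma continuous_radial : continuous h.
Proof. by move=> x; apply: differentiable_continuous; have [] := is_diff_radial x. Qed.

Variable pi : 'rV[R]_m.+1 -> R.
Hypothesis pi_C1 : continuously_differentiable pi.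
Local Notation T := (transformed h pi).

Definition transformed_grad x :=
  radial_jac (enorm x) *: (psi (enorm x) *: grad pi (h x) +
                           dotv (grad pi (h x)) x *: radial_field x) +
  pi (h x) *: (dradial_jac (enorm x) *: dirv x).

Lemma is_diff_transformed x : is_diff x T (dotv (transformed_grad x)).
Proof.
have dpi := differentiable_is_diff_grad (pi_C1.1 (h x)).
have h1 := is_diff_comp (is_diff_radial x) dpi.
have h2 := is_diff_radial_fun x is_derive_radial_jac dradial_jac0.
rewrite (_ : T = (pi \o h) * (radial_jac \o @enorm R m.+1)); last first.
  by apply/funext => y; rewrite transformedE.
have := is_diffM h1 h2; congr is_diff_def; apply/funext => v.
rewrite /transformed_grad /= !fctE /=.
rewrite !(dotvDl, dotvDr, dotvZl, dotvZr) /GRing.scale/=; ring.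
Qed.

Lemma continuous_transformed_grad : continuous transformed_grad.
Proof.
have cgp : continuous (fun x => grad pi (h x)).
  move=> x; apply: (@continuous_comp _ _ _ h (grad pi)); first exact: continuous_radial.
  exact: pi_C1.2.
have cpi : continuous pi.
  by move=> y; apply: differentiable_continuous; exact: pi_C1.1.
have ce (q : R -> R) : continuous q -> continuous (fun x => q (enorm x)).
  move=> cq x; apply: (@continuous_comp _ _ _ (@enorm R m.+1) q).
    exact: continuous_enorm.
  exact: cq.
have cA : continuous (fun x => dotv (grad pi (h x)) x *: radial_field x).
  move=> x; apply: (@continuousZ _ _ _ (fun y => dotv (grad pi (h y)) y)).
    by apply: (@continuous_dotv _ _ (fun y => grad pi (h y)) id) => // y; exact: cvg_id.
  apply: continuous_radial_field; last exact: dquot0.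
  exact: continuous_dquot fdf dfddf cddf f0 ddf0.
have cB : continuous (fun x => psi (enorm x) *: grad pi (h x)).
  move=> x; apply: (@continuousZ _ _ _ (fun y => psi (enorm y))); last exact: cgp.
  exact: (ce _ continuous_quot).
have cC : continuous (fun x => pi (h x) *: (dradial_jac (enorm x) *: dirv x)).
  move=> x; apply: (@continuousZ _ _ _ (fun y => pi (h y))).
    apply: (@continuous_comp _ _ _ h pi); first exact: continuous_radial.
    exact: cpi.
  apply: continuous_radial_field; last exact: dradial_jac0.
  exact: continuous_dradial_jac.
move=> x; apply: (@continuousD R 'rV[R]_m.+1 _
  (fun x => radial_jac (enorm x) *: (psi (enorm x) *: grad pi (h x) +
     dotv (grad pi (h x)) x *: radial_field x)) _ x); last exact: cC.
apply: (@continuousZ _ _ _ (fun y => radial_jac (enorm y))).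
  exact: (ce _ (is_derive_continuous is_derive_radial_jac)).
by apply: (@continuousD R 'rV[R]_m.+1 _ _ _ x); [exact: cB|exact: cA].
Qed.

Lemma continuously_differentiable_transformed : continuously_differentiable T.
Proof.
split=> [x|]; first by have [] := is_diff_transformed x.
rewrite (_ : grad T = transformed_grad); first exact: continuous_transformed_grad.
by apply/funext => x; exact/is_diff_gradE/is_diff_transformed.
Qed.

Lemma transformed_gt0 : (forall y, 0 < pi y) -> forall x, 0 < T x.
Proof.
by move=> pi0 x; rewrite transformedE mulr_gt0// radial_jac_gt0// enorm_ge0.
Qed.

Lemma C1_positive_density_transformed : (forall M, exists s : R, M <= f s) ->
  C1_positive_density pi -> C1_positive_density T.
Proof.
move=> foo [[pi_ge0 ipi] pi0 _].
split; [|exact: transformed_gt0|exact: continuously_differentiable_transformed].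
split; first by move=> x; rewrite ltW// transformed_gt0.
rewrite -ipi -(@integral_radial _ m f df psi pi)//.
- by apply: eq_integral => t _; rewrite transformedE radialE.
- exact: is_derive_continuous dfddf.
- by move=> s s0; rewrite ltW// quot_gt0.
- by move=> s _; exact: quotK.
- by move=> y; apply: differentiable_continuous; exact: pi_C1.1.
- rewrite (_ : (fun x => _) = T).
    move=> y; apply: differentiable_continuous.
    exact: continuously_differentiable_transformed.1.
  by apply/funext => x; rewrite transformedE radialE.
Qed.

(** A unit step along the ray through x moves h x along the same ray at speed
    f'(|x|), which is where the factor of the first term comes from. *)
Lemma radial_log_derivative x : (forall y, 0 < pi y) -> x != 0 ->
  dotv (dirv x) (grad (@ln R \o T) x) =
  df (enorm x) * dotv (dirv (h x)) (grad (@ln R \o pi) (h x)) +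
  dradial_jac (enorm x) / radial_jac (enorm x).
Proof.
move=> pi0 x0.
rewrite (grad_ln (continuously_differentiable_transformed.1 x) (transformed_gt0 pi0 x)).
rewrite (grad_ln (pi_C1.1 (h x)) (pi0 _)) dirv_radial.
rewrite (is_diff_gradE (is_diff_transformed x)) transformedE.
rewrite -[df (enorm x)](dquotK f) /transformed_grad /radial_field.
rewrite !(dotvDl, dotvDr, dotvZl, dotvZr) -sqr_enorm (dotvC x).
have a0 : enorm x != 0 by rewrite enorm_eq0.
have J0 : radial_jac (enorm x) != 0 by rewrite gt_eqF// radial_jac_gt0// enorm_ge0.
have P0 : pi (h x) != 0 by rewrite gt_eqF.
by field; rewrite a0 J0 P0.
Qed.

(** The logarithmic derivative of J = psi^m f' is m psi'/psi + f''/f', and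
    psi'/psi = f'/f - 1/s is at most f'/f. *)
Lemma dradial_jac_le s : 0 < s ->
  dradial_jac s / radial_jac s <= m%:R * (df s / f s) + ddf s / df s.
Proof.
move=> s0.
have p0 : psi s != 0 by rewrite gt_eqF// quot_gt0// ltW.
have d0 : df s != 0 by rewrite gt_eqF.
have -> : dradial_jac s / radial_jac s = m%:R * (dpsi s / psi s) + ddf s / df s.
  rewrite /dradial_jac /radial_jac; case: m => [|l] /=.
    by rewrite !expr0; field; rewrite ?p0 ?d0.
  by rewrite exprS; field; rewrite ?expf_neq0 ?p0 ?d0.
rewrite lerD2r ler_wpM2l// -(quotK df f0 s) -[df s in leRHS](dquotK f).
rewrite (_ : (_ + _) / _ = s^-1 + dpsi s / psi s); last first.
  by field; rewrite p0 gt_eqF.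
by rewrite lerDr invr_ge0 ltW.
Qed.

(** At h x the hypothesis contributes - alpha f'/f, because |h x| = f(|x|); the
    m angular factors psi of the Jacobian give back at most m f'/f. *)
Lemma radial_log_derivative_le (alpha R0 : R) x : (forall y, 0 < pi y) ->
  (forall y : 'rV[R]_m.+1, R0 < enorm y ->
    dotv (dirv y) (grad (@ln R \o pi) y) <= - (alpha / enorm y)) ->
  0 < enorm x -> R0 < f (enorm x) ->
  dotv (dirv x) (grad (@ln R \o T) x) <=
  ddf (enorm x) / df (enorm x) - (alpha - m%:R) * (df (enorm x) / f (enorm x)).
Proof.
move=> pi0 pia x0 fR; rewrite radial_log_derivative//; last by rewrite -enorm_gt0.
have := pia (h x); rewrite enorm_radial => /(_ fR).
have := dradial_jac_le x0.
have := df_gt0 (enorm x).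
move: (dotv _ _) (dradial_jac _ / _) (ddf _ / _) => D J E d0 HJ HD.
have : df (enorm x) * D <= df (enorm x) * - (alpha / f (enorm x)).
  by rewrite ler_pM2l.
rewrite mulrN mulrCA => HD'; lra.
Qed.

End radial.

(** * Lightness *)

Section conclusion.
Context {R : realType}.

Lemma radial_comp k (g f : R -> R) :
  (forall s, 0 < s -> 0 < f s) ->
  radial g \o radial f = radial (k := k) (g \o f).
Proof.
move=> fgt0; apply/funext => x /=.
have [->|x0] := eqVneq x 0; first by rewrite /radial !eqxx.
have rE (u : R -> R) (y : 'rV[R]_k) : y != 0 ->
    radial u y = (u (enorm y) / enorm y) *: y.
  by move=> y0; rewrite /radial (negbTE y0).
have e0 : 0 < enorm x by rewrite enorm_gt0.
have fe0 : 0 < f (enorm x) by exact: fgt0.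
have eE : enorm (radial f x) = f (enorm x).
  by rewrite rE// enormZ gtr0_norm ?divr_gt0// divfK// gt_eqF.
have r0 : radial f x != 0 by rewrite -enorm_gt0 eE.
rewrite (rE g)// eE !rE// scalerA; congr (_ *: _).
by rewrite /=; field; rewrite !gt_eqF.
Qed.

Lemma light_indexNy k (T : 'rV[R]_k -> R) :
  (forall M, exists N, forall x, N < enorm x ->
     dotv (dirv x) (grad (@ln R \o T) x) <= M) ->
  light_index T = -oo%E.
Proof.
move=> H; rewrite /light_index limf_esupE.
have key M : (ereal_inf [set ereal_sup
    ((fun x => (dotv (dirv x) (grad (@ln R \o T) x))%:E) @` V) |
    V in enorm_pinfty] <= M%:E)%E.
  have [N NP] := H M.
  apply: (@le_trans _ _ (ereal_sup
    ((fun x => (dotv (dirv x) (grad (@ln R \o T) x))%:E) @` [set x | N < enorm x]))).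
    by apply: ereal_inf_lbound; exists [set x | N < enorm x] => //; exists N.
  by apply: ge_ereal_sup => _ [x Nx <-]; rewrite lee_fin; exact: NP.
move: key; case: ereal_inf => [s|/(_ 0)|]//.
by move/(_ (s - 1)); rewrite lee_fin lerBrDr gerDl ler10.
Qed.

(** Here g = f1 r p satisfies g' >= a - r and g''/g' <= p - 1 as soon as
    a - r >= 1.  The leading terms b g' of f''/f' and c b g' of c f'/f combine to
    -(c - 1) b g'. *)
Lemma f12_log_derivative_bound (r p b c a : R) : 0 <= r -> 2 < p -> 0 < b ->
  1 <= c -> r + 1 <= a -> b^-1 < a ->
  ddf12 r p b a / df12 r p b a - c * (df12 r p b a / f12 r p b a) <=
  (p - 1) - (c - 1) * b * (a - r).
Proof.
move=> r0 p2 b0 c1 ra ba.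
have ga : b^-1 < f1 r p a by rewrite f1E// (lt_le_trans ba)// lerDl pospow_ge0.
have f0 : 0 < f12 r p b a.
  rewrite -(f2_0 b0) -(f1_0 r0 p2) -[ltLHS]/(f12 r p b 0).
  apply: (gt0_is_derive_lt (fun x => is_derive_f12 r x p2 b0)).
    by move=> x; exact: df12_gt0.
  by rewrite (le_lt_trans _ ba)// invr_ge0 ltW.
move: f0; rewrite /f12 /df12 /ddf12 /df2 /ddf2 /switch_at /= /f2 ga.
set E := expR (b * f1 r p a) => f0.
have E0 : 0 < E by exact: expR_gt0.
have fE : E - expR 1 / 3 <= E by rewrite gerBl divr_ge0// expR_ge0.
have g1 := df1_ge1 r a p2.
set s := a - r.
have s1 : 1 <= s by rewrite /s; lra.
have s0 : 0 < s by lra.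
have P0 : 0 < s `^ (p - 2) by rewrite powR_gt0.
have gE : df1 r p a = 1 + p * (s * s `^ (p - 2)).
  rewrite /df1 pospowE//; congr (_ + _ * _).
  rewrite (_ : p - 2 = p - 1 - 1); last by ring.
  by rewrite mulr_powRB1 ?ltW//; lra.
have hE : ddf1 r p a = p * (p - 1) * s `^ (p - 2) by rewrite /ddf1 pospowE.
have P1 : 1 <= s `^ (p - 2) by rewrite -[leLHS](powRr0 s) ler_powR//; lra.
have sP : s <= s * s `^ (p - 2) by rewrite ler_peMr// ltW.
have gs : s <= df1 r p a.
  have : p * s <= p * (s * s `^ (p - 2)) by rewrite ler_pM2l//; lra.
  have : 2 * s <= p * s by rewrite ler_pM2r// ltW.
  rewrite gE; lra.
have G0 : 0 < df1 r p a by lra.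
have hg : ddf1 r p a / df1 r p a <= p - 1.
  rewrite ler_pdivrMr// hE gE.
  have : p * (p - 1) * s `^ (p - 2) <= p * (p - 1) * (s * s `^ (p - 2)).
    by rewrite ler_pM2l ?ler_peMl// ?mulr_gt0//; lra.
  move: (s * _) => u; nra.
have fg : b * df1 r p a <= b * E * df1 r p a / (E - expR 1 / 3).
  rewrite ler_pdivlMr// mulrAC ler_pM2r// ler_pM2l//.
have -> : (b ^+ 2 * E * df1 r p a ^+ 2 + b * E * ddf1 r p a) / (b * E * df1 r p a) =
    b * df1 r p a + ddf1 r p a / df1 r p a.
  by field; rewrite !gt_eqF.
have : c * (b * df1 r p a) <= c * (b * E * df1 r p a / (E - expR 1 / 3)).
  by rewrite ler_pM2l//; lra.
have : (c - 1) * b * s <= (c - 1) * b * df1 r p a.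
  by rewrite ler_wpM2l// mulr_ge0 ?subr_ge0// ltW.
move: (_ / (E - _)) (_ / df1 _ _ _) hg => u w hg h1 h2; lra.
Qed.

End conclusion.

Theorem corollary1 (R : realType) (k : nat) (pi_beta : 'rV[R]_k -> R)
    (r p b : R) :
  (1 <= k)%N ->
  sub_exponentially_light pi_beta ->
  (exists alpha R0 : R, k%:R < alpha /\
    forall beta : 'rV[R]_k, R0 < enorm beta ->
      dotv (dirv beta) (grad (@ln R \o pi_beta) beta) <= - (alpha / enorm beta)) ->
  0 <= r -> 2 < p -> 0 < b ->
  let h := radial (f2 b) \o radial (f1 r p) in
  super_exponentially_light (transformed h pi_beta).
Proof.
case: k pi_beta => // m pi_beta _ [piD _] [alpha [R0 [malpha piR]]] r0 p2 b0 h.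
have [_ pi0 piC1] := piD.
have fdf (x : R) := is_derive_f12 r x p2 b0.
have dfddf (x : R) := is_derive_df12 r x p2 b0.
have cddf := @continuous_ddf12 _ r p b p2 b0.
have f0 : f12 r p b 0 = 0 by rewrite /f12/= f1_0// f2_0.
have ddf0 := ddf12_0 r0 p2 b0.
have df_gt0 x := df12_gt0 r x p2 b0.
have foo := f12_unbounded r p2 b0.
have -> : h = radial (f12 r p b).
  apply: radial_comp => s s0.
  by rewrite f1E// ltr_pwDl// pospow_ge0.
split; first exact: (C1_positive_density_transformed fdf dfddf).
apply: light_indexNy => M.
have [A fA] := foo (R0 + 1).
pose c := alpha - m%:R.
have c1 : 1 < c by rewrite /c ltrBrDr addrC natr1.
(* |x| > A makes |h x| > R0, and the last threshold brings the bound on the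
   logarithmic derivative below M. *)
pose N := Num.max (Num.max A b^-1)
  (Num.max (r + 1) (r + (p - 1 - M) / ((c - 1) * b))).
exists N => x.
rewrite !gt_max => /andP[/andP[Ax bx] /andP[rx Mx]].
have x0 : 0 < enorm x by rewrite (lt_trans _ bx)// invr_gt0.
have fR : R0 < f12 r p b (enorm x).
  have := gt0_is_derive_lt fdf df_gt0 Ax; lra.
have := radial_log_derivative_le fdf dfddf cddf f0 ddf0 df_gt0 piC1 pi0 piR x0 fR.
move=> /le_trans; apply.
apply: (le_trans (f12_log_derivative_bound r0 p2 b0 (ltW c1) (ltW rx) bx)).
have cb : 0 < (c - 1) * b by rewrite mulr_gt0// subr_gt0.
move: Mx; rewrite -ltrBrDl ltr_pdivrMr//; move: (_ * b) => u Mx.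
by rewrite lerBlDr -lerBlDl mulrC ltW.
Qed.
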